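(* Consider the PageRank Iteration algorithm applied to an instance $(\mathcal{G},v,\mathcal{F})$ of the undamped Max-PageRank problem. Then: (I) If (AD) every node has at least one outgoing edge in $\mathcal{E}\setminus\mathcal{F}$, and (AR) there exists at least one configuration under which $v$ can be reached with positive probability from every node, then the algorithm terminates after finitely many iterations and outputs an optimal configuration $F_k$ (one maximizing the PageRank of $v$ over all configurations) and the optimal value $1/H_k(v)$. (I I) Fix any constant $\kappa$. On instances satisfying (ABR): from every node of $\mathcal{G}$ there is a directed path to $v$ consisting of at most $\kappa$ edges of $\mathcal{E}\setminus\mathcal{F}$, the algorithm finds an optimal solution in time polynomial in the input size.
   Context: Let $\mathcal{G}=(\mathcal{V},\mathcal{E})$ be a directed graph, $v\in\mathcal{V}$, and $\mathcal{F}\subseteq\mathcal{E}$ a set of controllable (''fragile'') edges; edges in $\mathcal{E}\setminus\mathcal{F}$ are fixed. A configuration is a subset $F\subseteq\mathcal{F}$ of activated fragile edges; the resulting graph is $(\mathcal{V},(\mathcal{E}\setminus\mathcal{F})\cup F)$ and its random walk has column-stochastic transition matrix $P_F=(D_A^{-1}A)^{\mathrm T}$, $D_A=\mathrm{diag}(A\mathbf 1)$, where $A$ is its adjacency matrix (uniform moves along out-edges). No damping is used ($c=0$): the PageRank of $v$ under a configuration is $1/\varphi(v)$, where $\varphi(v)=\mathbb E[\min\{t\ge1:X_t=v\}\mid X_0=v]$ is the expected first return time to $v$ of this random walk, with the convention $1/\infty=0$. The PageRank Iteration algorithm: set $k=0$, $F_0=\mathcal{F}$; repeat: compute for every node $i$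 the expected first hitting time $H_k(i)=\mathbb E[\min\{t\ge1:X_t=v\}\mid X_0=i]$ for the walk under configuration $F_k$ (equivalently $H_k=\mathbf 1^{\mathrm T}(I-Q_k)^{-1}$, where $Q_k$ is $P_{F_k}$ with the column... i.e. $Q_k=\mathrm{diag}(\mathbf 1-e_v)P_{F_k}$ in the paper's convention); set $F_{k+1}=\{(i,j)\in\mathcal{F}: H_k(i)\ge H_k(j)+1\}$; $k:=k+1$; until $F_{k-1}=F_k$. Output $1/H_k(v)$ and $F_k$.
   Formalization: In the update F_{k+1}, for fragile edges (i,v) into v the value H_k(v) is replaced by 0 (condition H_k(i) ≥ 1), since with the return time H_k(v) the algorithm can drop edges into v and end at a non-optimal configuration. *)

(* Defs.v *)
From HB Require Import structures.
From mathcomp Require Import all_boot all_order all_algebra.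
From mathcomp Require Import all_classical all_reals all_analysis.

Set Implicit Arguments.
Unset Strict Implicit.
Unset Printing Implicit Defensive.

Import Order.TTheory GRing.Theory Num.Theory.

Local Open Scope ring_scope.

Record instance (n : nat) := Instance {
  edges : {set 'I_n * 'I_n};
  target : 'I_n;
  fragile : {set 'I_n * 'I_n};
  fragile_sub : fragile \subset edges
}.

Section MaxPageRank.
Variables (R : realType) (n : nat) (I : instance n).

Local Notation v := (target I).

Implicit Types (X : {set 'I_n * 'I_n}) (i j : 'I_n).

Definition fixed : {set 'I_n * 'I_n} := edges I :\: fragile I.

Definition configuration X : bool := X \subset fragile I.

Definition adjacency X : 'M[R]_n :=
  \matrix_(i, j) ((i, j) \in fixed :|: X)%:R.

Definition out_degree X i : R := \sum_j adjacency X i j.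

(* Column-stochastic: [transition X j i] is the probability of moving from i
   to j.  Since 0^-1 = 0, the column of a node without outgoing edge is zero:
   the walk stops there, without having reached v. *)
Definition transition X : 'M[R]_n :=
  (diag_mx (\row_i (out_degree X i)^-1) *m adjacency X)^T.

(* Probability that X_1, ..., X_t are the entries of w, given X_0 = i. *)
Fixpoint path_prob X i (w : seq 'I_n) : R :=
  if w is j :: w' then transition X j i * path_prob X j w' else 1.

(* P(tau = t | X_0 = i) for tau = min {t >= 1 : X_t = v}: the total
   probability of the trajectories (X_1, ..., X_t) whose first visit to v
   is their last entry X_t.  It is zero for t = 0. *)
Definition first_hit_prob X i (t : nat) : R :=
  \sum_(w : t.-tuple 'I_n | (index v w).+1 == t) path_prob X i w.

(* E(tau | X_0 = i), where tau = +oo has the remaining probability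
   (recall that +oo * 0 = 0).  At i = v this is the expected return time. *)
Definition hitting_time X i : \bar R :=
  (\sum_(0 <= t <oo) (t%:R * first_hit_prob X i t)%:E
   + +oo * (1 - \sum_(0 <= t <oo) (first_hit_prob X i t)%:E))%E.

(* Inversion in \bar R satisfies 1 / +oo = 0. *)
Definition pagerank X : \bar R := ((hitting_time X v)^-1)%E.

Definition max_pagerank : \bar R :=
  ereal_sup [set pagerank X | X in [set X | configuration X]]%classic.

Definition optimal X : Prop :=
  configuration X /\ forall Y, configuration Y -> (pagerank Y <= pagerank X)%E.

(* Expected time still needed to reach v once an edge with head j has been
   traversed.  It is H(j) except that nothing is left to do when j = v,
   whereas H(v) is the time of the *next* visit to v.  Comparing H(i) with
   H(v) + 1 for an edge (i, v) would discard edges leading straight to v, and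
   the algorithm would not be correct: for the fixed edges v -> a, a -> b,
   b -> v and the fragile edge a -> v it would return the empty configuration,
   of value 1/3, instead of the optimum 2/5. *)
Definition remaining_time X j : \bar R :=
  if j == v then 0%E else hitting_time X j.

Definition next_config X : {set 'I_n * 'I_n} :=
  [set e in fragile I |
    (remaining_time X e.2 + 1 <= hitting_time X e.1)%E]%SET.

Definition iterate (k : nat) : {set 'I_n * 'I_n} :=
  iter k next_config (fragile I).

(* The repeat-until loop is left after exactly k passes. *)
Definition terminates_at (k : nat) : Prop :=
  [/\ (0 < k)%N, iterate k.-1 = iterate k
    & forall j, (0 < j < k)%N -> iterate j.-1 != iterate j].

(* The outputs F_k and 1 / H_k(v) after k passes solve the instance. *)
Definition solves (k : nat) : Prop :=
  optimal (iterate k) /\ ((hitting_time (iterate k) v)^-1)%E = max_pagerank.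

Definition AD : Prop := forall i, exists j, (i, j) \in fixed.

Definition AR : Prop :=
  exists2 X, configuration X & forall i, exists t, 0 < (transition X ^+ t) v i.

(* The empty path is allowed from v itself. *)
Definition ABR (kappa : nat) : Prop :=
  forall i, exists p : seq 'I_n,
    [/\ path (fun x y => (x, y) \in fixed) i p, last i p = v
      & (size p <= kappa)%N].

End MaxPageRank.

Definition input_size (n : nat) (I : instance n) : nat := (n + #|edges I|)%N.

(* Running times refer to while-programs over integer arrays under the
   logarithmic cost criterion: each operation is charged the binary length of
   its operands (schoolbook cost for products and quotients), and each memory
   access the length of the address and of the contents.  Up to a polynomial,
   this is the running time of a Turing machine. *)

Definition bits (z : int) : nat := (trunc_log 2 `|z|%N).+1.

Definition store := nat -> int -> int.

Inductive expr :=
  | Const of int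
  | Read of nat & expr
  | Add of expr & expr
  | Sub of expr & expr
  | Mul of expr & expr
  | Div of expr & expr.

Inductive cmd :=
  | Skip
  | Write of nat & expr & expr
  | Seq of cmd & cmd
  | If of expr & cmd & cmd
  | While of expr & cmd.

Fixpoint eval (s : store) (e : expr) : int :=
  match e with
  | Const z => z
  | Read a e => s a (eval s e)
  | Add e1 e2 => eval s e1 + eval s e2
  | Sub e1 e2 => eval s e1 - eval s e2
  | Mul e1 e2 => eval s e1 * eval s e2
  | Div e1 e2 => (eval s e1 %/ eval s e2)%Z
  end.

Fixpoint eval_cost (s : store) (e : expr) : nat :=
  match e with
  | Const z => bits z
  | Read a e1 => eval_cost s e1 + bits (eval s e1) + bits (eval s e)
  | Add e1 e2 | Sub e1 e2 =>
      eval_cost s e1 + eval_cost s e2 + bits (eval s e1) + bits (eval s e2)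
  | Mul e1 e2 | Div e1 e2 =>
      eval_cost s e1 + eval_cost s e2 + bits (eval s e1) * bits (eval s e2)
  end%N.

Definition update (s : store) (a : nat) (p z : int) : store :=
  fun b q => if (b == a) && (q == p) then z else s b q.

(* [exec c s t s']: started in s, the program c halts in s' at cost t.
   A test succeeds when its value is positive. *)
Inductive exec : cmd -> store -> nat -> store -> Prop :=
  | exec_skip s : exec Skip s 1 s
  | exec_write a e1 e2 s :
      exec (Write a e1 e2) s
        (eval_cost s e1 + eval_cost s e2
         + bits (eval s e1) + bits (eval s e2))%N
        (update s a (eval s e1) (eval s e2))
  | exec_seq c1 c2 s1 s2 s3 t1 t2 :
      exec c1 s1 t1 s2 -> exec c2 s2 t2 s3 ->
      exec (Seq c1 c2) s1 (t1 + t2)%N s3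
  | exec_if e c1 c2 s t s' :
      exec (if 0 < eval s e then c1 else c2) s t s' ->
      exec (If e c1 c2) s (eval_cost s e + bits (eval s e) + t)%N s'
  | exec_while_stop e c s :
      ~~ (0 < eval s e) ->
      exec (While e c) s (eval_cost s e + bits (eval s e))%N s
  | exec_while_step e c s1 s2 s3 t1 t2 :
      0 < eval s1 e -> exec c s1 t1 s2 -> exec (While e c) s2 t2 s3 ->
      exec (While e c) s1
        (eval_cost s1 e + bits (eval s1 e) + t1 + t2)%N s3.

Definition arr_params : nat := 0.
Definition arr_edges : nat := 1.
Definition arr_fragile : nat := 2.
Definition arr_config : nat := 3.
Definition arr_num : nat := 4.
Definition arr_den : nat := 5.
Definition arr_changed : nat := 6.

Section Implementation.
Variables (R : realType) (n : nat) (I : instance n).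

Definition position (e : 'I_n * 'I_n) : int := (e.1 * n + e.2)%N%:Z.

Definition bitmap (X : {set 'I_n * 'I_n}) (p : int) : int :=
  ([exists e in X, p == position e] : nat)%:Z.

Definition input : store := fun a p =>
  if a == arr_params then
    if p == 0 then n%:Z else if p == 1 then (target I : nat)%:Z else 0
  else if a == arr_edges then bitmap (edges I) p
  else if a == arr_fragile then bitmap (fragile I) p
  else 0.

Definition holds_config (s : store) (X : {set 'I_n * 'I_n}) : Prop :=
  forall e, s arr_config (position e) = ((e \in X) : nat)%:Z.

(* H(i) = num(i) / den(i), where den(i) = 0 stands for +oo.  In particular
   the PageRank 1 / H(v) can be read off as the fraction den(v) / num(v). *)
Definition holds_hitting_times (s : store) (X : {set 'I_n * 'I_n}) : Prop :=
  forall i : 'I_n,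
    0 < s arr_num (i : nat)%:Z /\
    (hitting_time R I X i)^-1%E =
      ((s arr_den (i : nat)%:Z)%:~R / (s arr_num (i : nat)%:Z)%:~R)%:E.

Definition holds_changed (s : store) (b : bool) : Prop :=
  s arr_changed 0 = (b : nat)%:Z.

(* Running [init] on the encoded instance and then k times [body] carries out,
   at total cost T, the first k passes of the algorithm: [init] sets F_0, and
   the pass number j computes H_j, F_j.+1 and the outcome of the loop test
   (charged one unit). *)
Definition runs_iteration (init body : cmd) (k T : nat) : Prop :=
  exists (s : nat -> store) (t0 : nat) (t : nat -> nat),
    [/\ exec init input t0 (s 0%N) /\ holds_config (s 0%N) (iterate R I 0),
        forall j, (j < k)%N -> exec body (s j) (t j) (s j.+1),
        forall j, (j < k)%N ->
          [/\ holds_hitting_times (s j.+1) (iterate R I j),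
              holds_config (s j.+1) (iterate R I j.+1)
            & holds_changed (s j.+1) (iterate R I j.+1 != iterate R I j)]
      & T = (t0 + \sum_(j < k) (t j).+1)%N].

End Implementation.

(* Main.v *)
(* Give every fragile edge that is switched off the meaning "stay at the tail
   for free".  The configurations are then the policies of a stochastic
   shortest path problem, in which a pass of the algorithm is policy iteration,
   and the hitting times decrease to those of an optimal configuration.

   Under (ABR) hitting times are at most polynomial.  Weighted by the optimal
   hitting times, the relative error shrinks by a factor 1 - 1/(n b) per pass,
   where b bounds the hitting times.  Hitting times are quotients of
   determinants with polynomially many bits, so an error that is small enough
   is zero, which happens after polynomially many passes.

   A pass solves the linear system for the hitting times by fraction-free
   (Bareiss) Gauss-Jordan elimination, which keeps all the entries minors of
   the system.  No pivoting is needed, as the system is an M-matrix. *)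
Require Import Defs.
From mathcomp Require Import all_boot all_order all_algebra.
From mathcomp Require Import all_classical all_reals all_analysis.
From mathcomp Require Import perm ring lra zify.

Set Implicit Arguments.
Unset Strict Implicit.
Unset Printing Implicit Defensive.

Import Order.TTheory GRing.Theory Num.Theory.
Local Open Scope ring_scope.

(** Hitting times are series in [\bar R] and may be infinite, whereas policy iteration argues with
    linear inequalities. Two comparison principles bridge the gap: a nonnegative supersolution of
    the one-step equations bounds the hitting times from above, which also proves them finite, and
    finite hitting times dominate every subsolution. The old hitting times are a supersolution for
    the next configuration; those of a fixpoint are a subsolution for every competitor. The node v
    needs care: (ABR) allows it to have no outgoing edge at all, so finiteness is asked only at
    nodes with an outgoing edge in the full graph. The first configuration contains every edge; a
    rank function decreasing towards v bounds its hitting times by (2n)^L + 1, which is polynomial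
    for L = kappa. In the cost analysis each array is filled by a single loop, each cell has a
    closed description, and all of these values are at most 2^(8(n+1)^2) in absolute value. A pass
    then costs a constant read off from the program text, times the number of cells, times the
    squared word size. *)

Lemma instance_gt0 n (I : instance n) : (0 < n)%N.
Proof. by case: (target I) => i; case: n {I}. Qed.

(** * Hitting times *)

Section HittingTime.
Variables (R : realType) (n : nat) (I : instance n).
Local Notation v := (target I).
Implicit Types (X : {set 'I_n * 'I_n}) (i j : 'I_n) (x y : 'I_n -> R).

Definition present X : {set 'I_n * 'I_n} := fixed I :|: X.
Definition deg X i : nat := #|[set j | (i, j) \in present X]|.
Definition rem_at x j : R := if j == v then 0 else x j.
Definition succ_sum X x i : R := \sum_(j | (i, j) \in present X) (1 + rem_at x j).
(* The junk value is 0 when the hitting time is infinite. *)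
Definition finite_hit X i : R := fine (hitting_time R I X i).

Local Notation P X i j := (transition R I X j i).
Local Notation f X i t := (first_hit_prob R I X i t).

Lemma out_degreeE X i : out_degree R I X i = (deg X i)%:R.
Proof.
rewrite /out_degree /deg -sum1dep_card natr_sum [RHS]big_mkcond /=.
by apply: eq_bigr => j _; rewrite mxE; case: ifP.
Qed.

Lemma transitionE X i j :
  P X i j = (if (i, j) \in present X then (deg X i)%:R^-1 else 0).
Proof.
rewrite /transition !mxE (bigD1 i) //= !mxE eqxx big1 => [|k /negPf ki].
  by rewrite addr0 out_degreeE; case: ifP; rewrite /= (mulr1, mulr0).
by rewrite !mxE eq_sym ki mul0r.
Qed.

Lemma transition_ge0 X i j : 0 <= P X i j.
Proof. by rewrite transitionE; case: ifP; rewrite // invr_ge0. Qed.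

Lemma sum_transition X i (F : 'I_n -> R) :
  \sum_j P X i j * F j = (deg X i)%:R^-1 * \sum_(j | (i, j) \in present X) F j.
Proof.
rewrite big_distrr /= [RHS]big_mkcond; apply: eq_bigr => j _.
by rewrite transitionE; case: ifP; rewrite ?mul0r.
Qed.

Lemma succ_const X i (c : R) : \sum_(j | (i, j) \in present X) c = (deg X i)%:R * c.
Proof. by rewrite mulr_natl /deg -sumr_const; apply: eq_bigl => j; rewrite inE. Qed.

Lemma exists_succ_le X i (F : 'I_n -> R) c : (0 < deg X i)%N ->
  \sum_(j | (i, j) \in present X) F j <= (deg X i)%:R * c ->
  exists2 j, (i, j) \in present X & F j <= c.
Proof.
move=> d0 le_sum; apply/exists_inP; apply: contraLR le_sum.
rewrite negb_exists_in -ltNge -succ_const => /forall_inP lt_c.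
apply: ltr_sum => [|j ij]; last by rewrite ltNge lt_c.
case/card_gt0P: d0 => j; rewrite inE => ij.
by apply/hasP; exists j; rewrite ?mem_index_enum.
Qed.

Lemma sum_transition1 X i : \sum_j P X i j = (0 < deg X i)%:R.
Proof.
under eq_bigr do rewrite -[P _ _ _]mulr1.
rewrite sum_transition succ_const mulr1.
by case: (deg X i) => [|m]; rewrite ?mulr0 // mulVf // pnatr_eq0.
Qed.

Lemma path_prob_ge0 X w : forall i, 0 <= path_prob R I X i w.
Proof. by elim: w => //= j w IH i; rewrite mulr_ge0 ?transition_ge0. Qed.

Lemma first_hit_prob_ge0 X i t : 0 <= f X i t.
Proof. by apply: sumr_ge0 => w _; apply: path_prob_ge0. Qed.

Lemma first_hit_prob0 X i : f X i 0 = 0.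
Proof. by rewrite /first_hit_prob big_pred0 // => w; rewrite tuple0. Qed.

Lemma first_hit_probS X i t :
  f X i t.+1 = \sum_j P X i j * (if j == v then (t == 0%N)%:R else f X j t).
Proof.
rewrite /first_hit_prob.
rewrite (reindex (fun p : 'I_n * t.-tuple 'I_n => cons_tuple p.1 p.2)) /=; last first.
  exists (fun w => (thead w, [tuple of behead w])) => [[j w] _ | w _] /=.
    by congr (_, _); apply: val_inj.
  by rewrite [RHS]tuple_eta.
rewrite -(pair_big_dep xpredT
  (fun j (w : t.-tuple 'I_n) => (index v (j :: w)).+1 == t.+1)
  (fun j (w : t.-tuple 'I_n) => P X i j * path_prob R I X j w)) /=.
apply: eq_bigr => j _; rewrite -big_distrr /=; congr (_ * _).
case: ifP => [_|_] //.
case: t => [|t] /=; last by rewrite big_pred0.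
by rewrite (big_pred1 [tuple]) // => w; apply/esym/eqP/tuple0.
Qed.

(** * Survival probabilities P(tau > t) *)

Definition survival X i t : R := 1 - \sum_(0 <= s < t.+1) f X i s.

Lemma survival0 X i : survival X i 0 = 1.
Proof. by rewrite /survival big_nat1 first_hit_prob0 subr0. Qed.

(** The term [1 - (0 < deg X i)%:R] accounts for a walk that stops at i: it never reaches v, so it
    survives forever. *)
Lemma survivalS X i t :
  survival X i t.+1 = 1 - (0 < deg X i)%:R + \sum_j P X i j * rem_at (survival X ^~ t) j.
Proof.
rewrite /survival big_nat_recl // first_hit_prob0 add0r.
under eq_bigr do rewrite first_hit_probS.
rewrite exchange_big /= -addrA; congr (_ + _).
rewrite -sum_transition1 -!sumrN -big_split /=; apply: eq_bigr => j _.
rewrite -big_distrr /= /rem_at; case: ifP => _; last by rewrite mulrBr mulr1; ring.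
by rewrite mulr0 addr0 big_nat_recl // big1 ?addr0 ?mulr1.
Qed.

Lemma survival_ge0 X t : forall i, 0 <= survival X i t.
Proof.
elim: t => [|t IH] i; first by rewrite survival0.
rewrite survivalS addr_ge0 ?subr_ge0 ?lern1 ?leq_b1 //.
apply: sumr_ge0 => j _; rewrite mulr_ge0 ?transition_ge0 // /rem_at.
by case: ifP.
Qed.

Lemma survival_le X i s t : (s <= t)%N -> survival X i t <= survival X i s.
Proof.
move=> st; rewrite lerD2l lerN2 (@big_cat_nat _ _ _ s.+1 _ t.+1) //= lerDl.
by apply: sumr_ge0 => ? _; apply: first_hit_prob_ge0.
Qed.

(** Summation by parts. The boundary term is subtracted, so bounds on sums of survival probabilities
    carry over to the truncated mean. *)
Lemma truncated_meanE X i t :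
  \sum_(0 <= s < t.+1) s%:R * f X i s =
  \sum_(0 <= s < t) survival X i s - t%:R * survival X i t.
Proof.
elim: t => [|t IH]; first by rewrite big_nat1 big_geq // !mul0r subr0.
rewrite big_nat_recr //= IH big_nat_recr //= -[in LHS]addrA -[in RHS]addrA.
congr (_ + _).
have -> : survival X i t = survival X i t.+1 + f X i t.+1.
  by rewrite /survival (big_nat_recr t.+1) //=; ring.
by rewrite -(natr1 t); ring.
Qed.

(** The partial sum is E(min(tau, t)). One step of the walk reduces it to the same quantity for t -
    1 at the successors, so induction on t propagates the supersolution inequality. The set D is
    closed under successors other than v, which lets nodes with infinite hitting time be left
    out. *)
Lemma sum_survival_le (D : {pred 'I_n}) X x :
  (forall i, i \in D -> [/\ 0 <= x i, (0 < deg X i)%N,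
     succ_sum X x i <= (deg X i)%:R * x i
     & forall j, (i, j) \in present X -> j != v -> j \in D]) ->
  forall t i, i \in D -> \sum_(0 <= s < t) survival X i s <= x i.
Proof.
move=> xD; elim=> [|t IH] i iD; have [x0 d0 xi cl] := xD i iD.
  by rewrite big_geq.
rewrite big_nat_recl // survival0.
under eq_bigr do rewrite survivalS d0 subrr add0r sum_transition.
rewrite -big_distrr /= exchange_big /=.
rewrite -(ler_pM2l (x := (deg X i)%:R)) ?ltr0n // mulrDr mulVKf ?pnatr_eq0 -?lt0n //.
apply: le_trans xi; rewrite /succ_sum big_split /= succ_const.
rewrite lerD2l; apply: ler_sum => j ij.
rewrite /rem_at; case: (eqVneq j v) => [_|jv]; first by rewrite big1.
exact: IH (cl j ij jv).
Qed.

(** * Total probability and mean of the hitting time *)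

Local Open Scope ereal_scope.

Definition mass X i : \bar R := \sum_(0 <= t <oo) (f X i t)%:E.
Definition mean X i : \bar R := \sum_(0 <= t <oo) (t%:R * f X i t)%:E.

Lemma mass_ge0 X i : 0 <= mass X i.
Proof. by apply: nneseries_ge0 => t _ _; rewrite lee_fin first_hit_prob_ge0. Qed.

Lemma mean_ge0 X i : 0 <= mean X i.
Proof.
by apply: nneseries_ge0 => t _ _; rewrite lee_fin mulr_ge0 ?first_hit_prob_ge0.
Qed.

Lemma mass_le1 X i : mass X i <= 1.
Proof.
apply: lime_le; first by apply: is_cvg_nneseries => t _ _; rewrite lee_fin first_hit_prob_ge0.
apply: nearW => -[|t]; first by rewrite big_geq.
rewrite sumEFin lee_fin; have := survival_ge0 X t i.
by rewrite /survival subr_ge0.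
Qed.

Lemma hitting_timeE X i :
  hitting_time R I X i = if mass X i == 1 then mean X i else +oo.
Proof.
rewrite /hitting_time -/(mass X i) -/(mean X i).
have [->|m1] := eqVneq (mass X i) 1; first by rewrite subee // mule0 adde0.
have ml : mass X i < 1 by rewrite lt_neqAle m1 mass_le1.
rewrite gt0_mulye ?addey //; first by rewrite gt_eqF // (lt_le_trans _ (mean_ge0 X i)).
by rewrite sube_gt0.
Qed.

Lemma hitting_time_ge0 X i : 0 <= hitting_time R I X i.
Proof. by rewrite hitting_timeE; case: ifP => // _; apply: mean_ge0. Qed.

Lemma hit_ge0 X i : (0 <= finite_hit X i)%R.
Proof. exact/fine_ge0/hitting_time_ge0. Qed.

(* A nonnegative supersolution of the hitting time equations dominates the
   partial sums of P(tau > t), hence bounds E(tau) and forces tau < oo. *)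
Lemma hitting_time_le (D : {pred 'I_n}) X x :
  (forall i, i \in D -> [/\ (0 <= x i)%R, (0 < deg X i)%N,
     (succ_sum X x i <= (deg X i)%:R * x i)%R
     & forall j, (i, j) \in present X -> j != v -> j \in D]) ->
  forall i, i \in D -> hitting_time R I X i <= (x i)%:E.
Proof.
move=> xD i iD; have sx := sum_survival_le xD.
have x0 : (0 <= x i)%R by have [] := xD i iD.
rewrite hitting_timeE; have -> : mass X i = 1.
  apply/eqP; rewrite eq_le mass_le1 /=; apply/lee_addgt0Pr => e e0.
  (* Markov's inequality: t P(tau > t) <= E(min(tau, t)) <= x i, so the missing probability is at
     most e once t exceeds x i / e. *)
  have [t te] : exists t : nat, (x i / e < t%:R)%R.
    exists (Num.bound (x i / e)); apply: archi_boundP.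
    by rewrite divr_ge0 // ltW.
  have st : (survival X i t <= e)%R.
    rewrite leNgt; apply/negP => lt_e.
    have : (t%:R * e <= x i)%R.
      apply: le_trans (sx t i iD).
      rewrite mulr_natl -[X in (_ *+ X)%R](subn0 t) -sumr_const_nat.
      rewrite big_nat_cond [leRHS]big_nat_cond; apply: ler_sum => s /andP[/andP[_ /ltnW lst] _].
      exact: le_trans (ltW lt_e) (survival_le X i lst).
    by rewrite leNgt -ltr_pdivrMr // te.
  have H : 1 <= \sum_(0 <= s < t.+1) (f X i s)%:E + e%:E.
    by rewrite sumEFin -EFinD lee_fin; move: st; rewrite /survival; lra.
  apply: le_trans H _; apply: leeD => //; apply: nneseries_lim_ge => s _ _.
  by rewrite lee_fin first_hit_prob_ge0.
rewrite eqxx; apply: lime_le.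
  by apply: is_cvg_nneseries => t _ _; rewrite lee_fin mulr_ge0 ?first_hit_prob_ge0.
apply: nearW => -[|t]; first by rewrite big_geq // lee_fin.
rewrite sumEFin lee_fin truncated_meanE; apply: le_trans (sx t i iD).
by rewrite gerBl mulr_ge0 ?survival_ge0.
Qed.

Lemma massE X i :
  mass X i = \sum_j (P X i j)%:E * (if j == v then 1 else mass X j).
Proof.
rewrite /mass nneseries_recl //; last by move=> t _; rewrite lee_fin first_hit_prob_ge0.
rewrite first_hit_prob0 add0e -nneseries_addn; last by move=> t;
  rewrite lee_fin first_hit_prob_ge0.
under eq_eseriesr do rewrite addn1 first_hit_probS -sumEFin.
have ge0 j t : (0 <= (if j == v then (t == 0%N)%:R else f X j t))%R.
  by case: ifP => _; rewrite ?first_hit_prob_ge0.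
rewrite nneseries_sum; last by move=> j t _; rewrite lee_fin mulr_ge0 ?transition_ge0.
apply: eq_bigr => j _; under eq_eseriesr do rewrite EFinM.
rewrite nneseriesZl; last by move=> t _; rewrite lee_fin.
congr (_ * _); case: ifP => // _.
rewrite nneseries_recl //.
rewrite [X in _ + X]eseries0 => [|[]] //.
by rewrite adde0.
Qed.

(** The first step adds 1 to tau, and (t + 1) f = t f + f: hence the mass of the successor next to
    its mean, as long as that mass is not known to be 1. *)
Lemma meanE X i :
  mean X i = \sum_j (P X i j)%:E * (if j == v then 1 else mean X j + mass X j).
Proof.
rewrite /mean nneseries_recl //; last by move=> t _; rewrite lee_fin mulr_ge0 ?first_hit_prob_ge0.
rewrite first_hit_prob0 mulr0 add0e -nneseries_addn; last by move=> t;
  rewrite lee_fin mulr_ge0 ?first_hit_prob_ge0.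
have ge0 j t : (0 <= (if j == v then (t == 0%N)%:R else f X j t))%R.
  by case: ifP => _; rewrite ?first_hit_prob_ge0.
under eq_eseriesr do rewrite addn1 first_hit_probS big_distrr /= -sumEFin.
rewrite nneseries_sum; last by move=> j t _; rewrite lee_fin !mulr_ge0 ?transition_ge0.
apply: eq_bigr => j _.
under eq_eseriesr do rewrite mulrCA EFinM.
rewrite nneseriesZl; last by move=> t _; rewrite lee_fin mulr_ge0.
congr (_ * _); case: ifP => _.
  rewrite nneseries_recl //.
  rewrite [X in _ + X]eseries0 => [|[|t]] //; last by rewrite mulr0.
  by rewrite adde0 mulr1.
rewrite -nneseriesD => [|t _ _|t _ _]; last 2 first.
- by rewrite lee_fin mulr_ge0 ?first_hit_prob_ge0.
- by rewrite lee_fin first_hit_prob_ge0.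
by apply: eq_eseriesr => t _; rewrite -EFinD -natr1 mulrDl mul1r.
Qed.

Lemma mean_fin_num X i : (mean X i \is a fin_num) = (mean X i != +oo).
Proof. by rewrite ge0_fin_numE ?mean_ge0 // ltey. Qed.

(** Finiteness is inherited by successors. The mass 1 at i is a convex combination of masses at most
    1, and every present arc has positive weight, so each successor other than v has mass 1; an
    infinite mean there would make the mean at i infinite. With all masses equal to 1, [meanE]
    becomes the linear one-step equation. *)
Lemma hitting_time_fin X i : hitting_time R I X i \is a fin_num ->
  [/\ (0 < deg X i)%N,
      forall j, (i, j) \in present X -> j != v ->
        hitting_time R I X j \is a fin_num
    & succ_sum X (finite_hit X) i = ((deg X i)%:R * finite_hit X i)%R].
Proof.
rewrite hitting_timeE; case: eqP => // m1 fin_i.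
have d0 : (0 < deg X i)%N.
  rewrite lt0n; apply/eqP => d0; suff m0 : mass X i = 0 by rewrite m0 in m1;
    case: m1 => /eqP; rewrite eq_sym oner_eq0.
  rewrite massE big1 // => j _; rewrite transitionE.
  by case: ifP; rewrite ?d0 ?invr0 mul0e.
have Pgt0 j : (i, j) \in present X -> (0 < P X i j)%R.
  by move=> ij; rewrite transitionE ij invr_gt0 ltr0n.
have massj j : (i, j) \in present X -> j != v -> mass X j = 1.
  move=> ij jv; apply/eqP; rewrite eq_le mass_le1 /=.
  have : 1 <= (\sum_(k | k != j) P X i k)%:E + (P X i j)%:E * mass X j.
    rewrite -m1 massE (bigD1 j) //= (negPf jv) addeC leeD2r //.
    rewrite -sumEFin; apply: lee_sum => k _; rewrite -[leRHS]mule1.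
    apply: lee_pmul; rewrite ?lee_fin ?transition_ge0 //.
      by case: ifP; rewrite ?mass_ge0.
    by case: ifP; rewrite ?mass_le1.
  have := sum_transition1 X i; rewrite d0 (bigD1 j) //= => /(canRL (addKr _)) ->.
  have := mass_ge0 X j; have := mass_le1 X j.
  case: (mass X j) => [r||] // _ _; rewrite -EFinM -EFinD !lee_fin.
  have := Pgt0 j ij; nra.
have meanj j : (i, j) \in present X -> j != v -> mean X j \is a fin_num.
  move=> ij jv; rewrite mean_fin_num; apply/eqP => mj.
  move: fin_i; rewrite meanE (bigD1 j) //= (negPf jv) mj massj // addye // gt0_muley
    ?lte_fin ?Pgt0 //.
  rewrite addye //; rewrite gt_eqF // (lt_le_trans (ltNyr 0)) // sume_ge0 // => k _.
  rewrite mule_ge0 ?lee_fin ?transition_ge0 //; case: ifP => // _.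
  by rewrite adde_ge0 ?mean_ge0 ?mass_ge0.
have hitj j : (i, j) \in present X -> j != v -> mean X j = (finite_hit X j)%:E.
  by move=> ij jv; rewrite /finite_hit hitting_timeE massj // eqxx fineK ?meanj.
split=> // [j ij jv|]; first by rewrite hitting_timeE massj // eqxx meanj.
have : (finite_hit X i)%:E = (\sum_j P X i j * (1 + rem_at (finite_hit X) j))%:E.
  rewrite {1}/finite_hit hitting_timeE m1 eqxx fineK // meanE -sumEFin.
  apply: eq_bigr => j _; rewrite transitionE.
  case: ifP => [ij|_]; last by rewrite mul0e mul0r.
  rewrite /rem_at; case: (eqVneq j v) => [_|jv]; first by rewrite addr0 mule1 mulr1.
  by rewrite massj // hitj // -EFinD -EFinM addrC.
case=> ->; rewrite sum_transition mulrA mulfV ?mul1r //.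
by rewrite pnatr_eq0 -lt0n.
Qed.

Local Close Scope ereal_scope.

Lemma hit_ge1 X i : hitting_time R I X i \is a fin_num -> 1 <= finite_hit X i.
Proof.
case/hitting_time_fin => d0 _ e; rewrite -(ler_pM2l (x := (deg X i)%:R)) ?ltr0n //.
rewrite -e -succ_const; apply: ler_sum => j _.
by rewrite lerDl /rem_at; case: ifP; rewrite ?hit_ge0.
Qed.

(* Maximum principle: among the nodes maximizing the gap to x, the one with
   the smallest hitting time has a successor with a smaller hitting time. *)
Lemma hit_ge X x :
  (forall i, hitting_time R I X i \is a fin_num ->
     (deg X i)%:R * x i <= succ_sum X x i) ->
  forall i, hitting_time R I X i \is a fin_num -> x i <= finite_hit X i.
Proof.
move=> sub i0 fin0; rewrite leNgt; apply/negP => lt0.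
pose S := [pred i | hitting_time R I X i \is a fin_num].
pose gap i := x i - finite_hit X i.
have [/= a Sa maxa] := @arg_maxP _ _ _ i0 S gap fin0.
pose T := [pred i | S i && (gap i == gap a)].
have Ta : T a by rewrite /= Sa eqxx.
have [/= i /andP[Si /eqP gi] mini] := @arg_minP _ _ _ a T (finite_hit X) Ta.
have gpos : 0 < gap a by apply: lt_le_trans (maxa i0 fin0); rewrite subr_gt0.
have [d0 cl eqi] := hitting_time_fin Si.
have gap_le j : (i, j) \in present X -> rem_at x j - rem_at (finite_hit X) j <= gap a.
  move=> ij; rewrite /rem_at; case: (eqVneq j v) => jv; first by rewrite subrr ltW.
  exact/maxa/cl.
have [j ij hj] : exists2 j, (i, j) \in present X & 1 + rem_at (finite_hit X) j <= finite_hit X i.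
  by apply: exists_succ_le; rewrite // -eqi.
have gap_lt : rem_at x j - rem_at (finite_hit X) j < gap a.
  move: hj; rewrite lt_neqAle gap_le // andbT /rem_at.
  case: (eqVneq j v) => jv hj; first by rewrite subrr lt_eqF.
  apply/negP => gj; have := mini j; rewrite /= gj cl // => /(_ isT).
  by rewrite /= leNgt => /negP[]; apply: lt_le_trans hj; rewrite ltrDr.
have := sub i Si; rewrite leNgt => /negP; apply.
have -> : x i = finite_hit X i + gap a by rewrite -gi /gap addrC subrK.
rewrite mulrDr -eqi -succ_const -big_split /= /succ_sum.
rewrite (bigD1 j) //= [ltRHS](bigD1 j) //=; apply: ltr_leD; first by lra.
by apply: ler_sum => k /andP[/gap_le]; lra.
Qed.

End HittingTime.

(** * Policy iteration *)

Section PolicyIteration.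
Variables (R : realType) (n : nat) (I : instance n).
Local Notation v := (target I).
Local Notation H X i := (hitting_time R I X i).
Local Notation hit := (finite_hit R I).
Local Notation next := (next_config R I).
Local Notation F k := (iterate R I k).
Implicit Types (X Y : {set 'I_n * 'I_n}) (i j : 'I_n) (x y : 'I_n -> R).

(** A node that is not live has no outgoing arc under any configuration, hence an infinite hitting
    time. By [live_neq] below, v is the only node that may fail to be live. *)
Definition live i : bool := (0 < deg I (fragile I) i)%N.

Definition good X : Prop :=
  configuration I X /\ forall i, live i -> H X i \is a fin_num.

Lemma present_fragile : present I (fragile I) = edges I.
Proof.
apply/setP => e; rewrite !inE.
by case: (boolP (e \in fragile I)) => [/(fintype.subsetP (fragile_sub I)) ->|_]; rewrite ?orbF.
Qed.

Lemma present_sub X : configuration I X -> present I X \subset edges I.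
Proof. by move=> cX; rewrite -present_fragile finset.setUS. Qed.

Lemma in_present X i j : configuration I X -> (i, j) \in edges I ->
  ((i, j) \in present I X) = ((i, j) \in fragile I) ==> ((i, j) \in X).
Proof.
move=> /fintype.subsetP cX ij; rewrite !inE ij andbT.
by case: (boolP (_ \in fragile I)).
Qed.

Lemma hitting_time_dead X i : configuration I X -> ~~ live i -> H X i = +oo%E.
Proof.
move=> cX; rewrite /live -leqNgt leqn0 => /eqP d0.
have [/hitting_time_fin[dX _ _]|] := boolP (H X i \is a fin_num).
  have : (deg I X i <= deg I (fragile I) i)%N.
    apply: subset_leq_card; apply/fintype.subsetP => j; rewrite !inE.
    by case/orP => [->//|/(fintype.subsetP cX) ->]; rewrite orbT.
  by rewrite d0 leqNgt dX.
by rewrite ge0_fin_numE ?hitting_time_ge0 // ltey negbK => /eqP.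
Qed.

(* A fragile edge that is switched off sends the walk back to i at no cost. *)
Definition mixed_sum X x i : R :=
  \sum_(j | (i, j) \in edges I) if (i, j) \in present I X then 1 + rem_at I x j else x i.

(** Comparing [mixed_sum X x i] with the full degree times [x i] thus amounts to comparing
    [succ_sum] with [deg I X i] times [x i]. In the first form the index set does not depend on the
    configuration, so that configurations can be compared term by term. *)
Lemma mixed_sumE X x i : configuration I X ->
  mixed_sum X x i = succ_sum I X x i
    + ((deg I (fragile I) i)%:R - (deg I X i)%:R) * x i.
Proof.
move=> cX; rewrite mulrBl -!succ_const present_fragile addrC -addrA [- _ + _]addrC -sumrB.
rewrite /mixed_sum /succ_sum.
have big_pres (G : 'I_n -> R) : \sum_(j | (i, j) \in present I X) G j =
    \sum_(j | (i, j) \in edges I) if (i, j) \in present I X then G j else 0.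
  rewrite -big_mkcondr; apply: eq_bigl => j.
  by case: (boolP (_ \in present I X)) => [/(fintype.subsetP (present_sub cX)) ->|_];
    rewrite ?andbF.
rewrite big_pres -big_split; apply: eq_bigr => j _ /=.
by case: ifP => _; rewrite ?addr0 // addrC subrK.
Qed.

(* With a = 2n, the function a^L - a^(L - g) of the rank g is a supersolution:
   a successor of smaller rank has probability at least 1/n, and its value
   is smaller by more than the other successors can make up for. *)
Lemma hitting_time_rank X (g : 'I_n -> nat) L : g v = 0%N ->
  (forall i, (g i <= L)%N) ->
  (forall i, i != v -> exists2 j, (i, j) \in present I X & (g j < g i)%N) ->
  forall i, (0 < deg I X i)%N -> (H X i <= ((2 * n) ^ L).+1%:R%:E)%E.
Proof.
move=> gv gL gX.
pose a : R := (2 * n)%:R; have n0 := instance_gt0 I.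
have a1 : 1 <= a by rewrite ler1n muln_gt0 n0.
(* At v the value has to bound the return time, while arcs into v see the remaining time 0; the
   latter agrees with the general formula at rank 0. *)
pose x i := if i == v then 1 + a ^+ L else a ^+ L - a ^+ (L - g i).
have remE j : rem_at I x j = a ^+ L - a ^+ (L - g j).
  by rewrite /rem_at /x; case: eqVneq => [->|//]; rewrite gv subn0 subrr.
have pow_ge1 m : 1 <= a ^+ m by apply: exprn_ege1.
have pow_le m : a ^+ (L - m) <= a ^+ L by rewrite ler_weXn2l // leq_subr.
have aL : ((2 * n) ^ L).+1%:R = 1 + a ^+ L by rewrite -natr1 natrX addrC.
have sum_le i : succ_sum I X x i <= (deg I X i)%:R * (1 + a ^+ L).
  rewrite -succ_const; apply: ler_sum => j _; rewrite remE lerD2l gerBl.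
  exact: le_trans (pow_ge1 _).
have xP i : i \in [pred i | (0 < deg I X i)%N] -> [/\ 0 <= x i, (0 < deg I X i)%N,
     succ_sum I X x i <= (deg I X i)%:R * x i
     & forall j, (i, j) \in present I X -> j != v -> j \in [pred i | (0 < deg I X i)%N]].
  rewrite inE => di; split=> //.
  - rewrite /x; case: ifP => _; last by rewrite subr_ge0.
    by rewrite addr_ge0 // (le_trans _ (pow_ge1 _)).
  - rewrite {2}/x; case: (eqVneq i v) => [->|iv]; first exact: sum_le.
    have [j ij gji] := gX i iv.
    have -> : a ^+ L - a ^+ (L - g i) = (1 + a ^+ L) - (1 + a ^+ (L - g i)) by ring.
    rewrite mulrBr -succ_const /succ_sum (bigD1 j) //= [in leRHS](bigD1 j) //=.
    rewrite remE; set S1 := \sum_(k | _) _; set S2 := \sum_(k | _) _.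
    have S12 : S1 <= S2.
      apply: ler_sum => k _; rewrite remE lerD2l gerBl.
      exact: le_trans (pow_ge1 _).
    have dn : (deg I X i)%:R <= n%:R :> R.
      by rewrite ler_nat -[leqRHS]card_ord max_card.
    have ajE : a * a ^+ (L - g i) <= a ^+ (L - g j).
      by rewrite -exprS ler_weXn2l //; have := gL i; lia.
    have {ajE} : (deg I X i)%:R * (1 + a ^+ (L - g i)) <= a ^+ (L - g j).
      apply: le_trans ajE; have -> : a * a ^+ (L - g i) = n%:R * (a ^+ (L - g i) + a ^+ (L -
        g i)).
        by rewrite {1}/a natrM; ring.
      by apply: ler_pM; rewrite ?addr_ge0 ?lerD2r // (le_trans _ (pow_ge1 _)).
    move: S12; clear; set u := a ^+ L; set w := a ^+ (L - g i); set w' := a ^+ _.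
    move: (deg I X i)%:R u w w' S1 S2 => d u w w' S1 S2; lra.
  - by move=> j _ /gX[k jk _]; apply/card_gt0P; exists k; rewrite inE.
move=> i di; apply: le_trans (hitting_time_le xP di) _.
rewrite lee_fin aL /x; case: ifP => // _.
by rewrite lerBlDr -addrA ler_wpDl // lerDl (le_trans _ (pow_ge1 _)).
Qed.

(** * One improvement pass *)

Section Live.
Hypothesis live_neq : forall i, i != v -> live i.

Lemma hitting_time_hit X i : good X -> live i -> H X i = (hit X i)%:E.
Proof. by case=> _ gX li; rewrite /finite_hit fineK ?gX. Qed.

Lemma mixed_sum_hit X i : good X -> live i ->
  mixed_sum X (hit X) i = (deg I (fragile I) i)%:R * hit X i.
Proof.
move=> [cX gX] li; have [_ _ e] := hitting_time_fin (gX i li).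
by rewrite mixed_sumE // e; ring.
Qed.

Lemma edge_live i j : (i, j) \in edges I -> live i.
Proof. by move=> ij; apply/card_gt0P; exists j; rewrite inE present_fragile. Qed.

Lemma in_next_config X i j : good X -> (i, j) \in edges I ->
  ((i, j) \in next X) =
  ((i, j) \in fragile I) && (1 + rem_at I (hit X) j <= hit X i).
Proof.
move=> gX ij; rewrite inE /= (hitting_time_hit gX (edge_live ij)) [in RHS]addrC.
congr (_ && _); rewrite /remaining_time /rem_at.
case: eqVneq => [_|jv]; first by rewrite add0e add0r lee_fin.
by rewrite hitting_time_hit ?live_neq // -EFinD lee_fin.
Qed.

Lemma configuration_next X : configuration I (next X).
Proof. by apply/fintype.subsetP => e; rewrite inE => /andP[]. Qed.

(** The threshold of the algorithm picks, for each fragile edge, the smaller of the two possible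
    terms [1 + rem_at I (hit X) j] and [hit X i]: the pass is the greedy policy improvement. *)
Lemma mixed_sum_next_le X Y i : good X -> configuration I Y ->
  mixed_sum (next X) (hit X) i <= mixed_sum Y (hit X) i.
Proof.
move=> gX cY; apply: ler_sum => j ij.
rewrite !in_present ?configuration_next // in_next_config //.
case: (_ \in fragile I) => //=.
case: (leP (1 + rem_at I (hit X) j) (hit X i)) => [|/ltW] le1; by case: ifP.
Qed.

(** [hit X i] is the average of [1 + rem_at] over the successors, so some successor is no worse than
    the average; its edge meets the threshold and is kept. *)
Lemma deg_next_gt0 X i : good X -> live i -> (0 < deg I (next X) i)%N.
Proof.
move=> gX li; have [cX fX] := gX; have [d0 _ e] := hitting_time_fin (fX i li).
have [j ij le_j] : exists2 j, (i, j) \in present I X & 1 + rem_at I (hit X) j <= hit X i.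
  by apply: exists_succ_le; rewrite // -e.
have eij := fintype.subsetP (present_sub cX) _ ij.
apply/card_gt0P; exists j; rewrite inE in_present ?configuration_next //.
by rewrite in_next_config // le_j andbT; apply/implyP.
Qed.

Lemma next_super X i : good X -> live i ->
  succ_sum I (next X) (hit X) i <= (deg I (next X) i)%:R * hit X i.
Proof.
move=> gX li; have := mixed_sum_next_le i gX gX.1.
by rewrite mixed_sum_hit // mixed_sumE ?configuration_next // mulrBl; lra.
Qed.

Lemma hitting_time_next_le X i : good X -> live i -> (H (next X) i <= (hit X i)%:E)%E.
Proof.
move=> gX; apply: (@hitting_time_le _ _ _ live) => {}i li; split.
- exact: hit_ge0.
- exact: deg_next_gt0.
- exact: next_super.
- by move=> j _; apply: live_neq.
Qed.

Lemma good_next X : good X -> good (next X).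
Proof.
move=> gX; split=> [|i li]; first exact: configuration_next.
rewrite ge0_fin_numE ?hitting_time_ge0 //.
exact: le_lt_trans (hitting_time_next_le gX li) (ltry _).
Qed.

Lemma hit_next_le X i : good X -> live i -> hit (next X) i <= hit X i.
Proof.
move=> gX li; rewrite -lee_fin -hitting_time_hit //; last exact: good_next.
exact: hitting_time_next_le.
Qed.

Lemma rem_at_mono x y j : (forall i, i != v -> x i <= y i) -> rem_at I x j <= rem_at I y j.
Proof. by move=> xy; rewrite /rem_at; case: eqVneq => // /xy. Qed.

(** The new hitting times solve the mixed equations of [next X]; monotonicity allows the old ones on
    the right-hand side, and greediness allows any Y there. So a pass does at least as well as a
    Bellman step, which yields both optimality of fixpoints and the rate. *)
Lemma hit_next_le_mixed X Y i : good X -> configuration I Y -> live i ->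
  (deg I (fragile I) i)%:R * hit (next X) i <= mixed_sum Y (hit X) i.
Proof.
move=> gX cY li; apply: le_trans (mixed_sum_next_le i gX cY).
rewrite -mixed_sum_hit //; last exact: good_next.
apply: ler_sum => j ij; case: ifP => _; last exact: hit_next_le.
by rewrite lerD2l; apply: rem_at_mono => k /live_neq; apply: hit_next_le.
Qed.

(** At a fixpoint [hit_next_le_mixed] has [hit X] on both sides, so [hit X] is a subsolution for Y
    and [hit_ge] applies where Y has finite hitting times. *)
Lemma fixpoint_le X Y i : good X -> next X = X -> configuration I Y ->
  (H X i <= H Y i)%E.
Proof.
move=> gX eX cY; have [finY|] := boolP (H Y i \is a fin_num); last first.
  by rewrite ge0_fin_numE ?hitting_time_ge0 // ltey negbK => /eqP ->; rewrite leey.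
have liveY j : H Y j \is a fin_num -> live j.
  by move=> fj; apply/negP => /negP /(hitting_time_dead cY) e; rewrite e in fj.
rewrite (hitting_time_hit gX) ?liveY // -[leRHS]fineK // lee_fin.
apply: (hit_ge (x := hit X)) => // j /liveY lj.
have := hit_next_le_mixed gX cY lj; rewrite eX mixed_sumE // mulrBl; lra.
Qed.

Lemma hit_eq_next X Y : good X -> good Y ->
  (forall i, live i -> hit X i = hit Y i) -> next X = next Y.
Proof.
move=> gX gY e; have eH i : H X i = H Y i.
  have [li|li] := boolP (live i); first by rewrite !hitting_time_hit ?e.
  by rewrite !hitting_time_dead ?gX.1 ?gY.1.
by apply/setP => a; rewrite !inE /remaining_time !eH.
Qed.

(** * Termination and optimality *)

Section Run.
Hypothesis good0 : good (fragile I).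

Lemma good_iterate k : good (F k).
Proof. by elim: k => // k IH; apply: good_next. Qed.

Lemma hit_iterate_le k m i : (k <= m)%N -> live i -> hit (F m) i <= hit (F k) i.
Proof.
move=> km li; elim: m km => [|m IH]; first by rewrite leqn0 => /eqP ->.
rewrite leq_eqVlt => /predU1P[->//|/IH]; apply: le_trans.
exact: hit_next_le (good_iterate m) li.
Qed.

Lemma first_termination k : (0 < k)%N -> F k.-1 = F k ->
  exists2 m, terminates_at R I m & (m <= k)%N.
Proof.
move=> k0 ek; have ex : exists m, (0 < m)%N && (F m.-1 == F m).
  by exists k; rewrite k0 ek eqxx.
case: (ex_minnP ex) => m /andP[m0 /eqP em] minm; exists m.
  split=> // j /andP[j0 jm]; apply/eqP => ej.
  by have := minm j; rewrite j0 ej eqxx => /(_ isT); rewrite leqNgt jm.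
by apply: minm; rewrite k0 ek eqxx.
Qed.

Lemma terminates_fixpoint k : terminates_at R I k -> next (F k) = F k.
Proof. by case: k => [[]//|k] [_ /= e _]; rewrite -[RHS]/(next (F k)) {2}e. Qed.

Lemma terminates_solves k : terminates_at R I k -> solves R I k.
Proof.
move=> /terminates_fixpoint fixk; have gk := good_iterate k.
have opt : optimal R I (F k).
  split=> [|Y cY]; first exact: gk.1.
  by rewrite lee_pV2 ?inE ?hitting_time_ge0 ?fixpoint_le.
split=> //; apply/eqP; rewrite eq_le; apply/andP; split.
  by apply: ereal_sup_ubound; exists (F k) => //; apply: gk.1.
by apply: ge_ereal_sup => _ [Y cY <-]; apply: opt.2.
Qed.

(* A repetition of hitting times forces a repetition of configurations;
   otherwise the sum of the hitting times decreases forever, although there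
   are finitely many configurations. *)
Lemma terminates : exists k, terminates_at R I k.
Proof.
have [[k k0 ek]|noeq] := pselect (exists2 k, (0 < k)%N & F k.-1 = F k).
  by have [m] := first_termination k0 ek; exists m.
pose total k := \sum_(i | live i) hit (F k) i.
have total_lt k : total k.+1 < total k.
  rewrite lt_neqAle ler_sum ?andbT => [|i]; last exact: hit_iterate_le.
  apply/negP => /eqP e; apply: noeq; exists k.+2 => //=.
  apply: hit_eq_next (good_iterate k) (good_iterate k.+1) _ => i li.
  apply/esym/eqP; rewrite -subr_eq0 -oppr_eq0 opprB; apply/eqP.
  have /psumr_eq0P : \sum_(i | live i) (hit (F k) i - hit (F k.+1) i) = 0.
    by rewrite sumrB -/(total _) -/(total _) e subrr.
  apply=> // j lj; rewrite subr_ge0; exact: hit_iterate_le.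
have dec k m : (k < m)%N -> total m < total k.
  elim: m => // m IH; rewrite ltnS leq_eqVlt => /predU1P[->|/IH]; first exact: total_lt.
  exact/lt_trans/total_lt.
have inj : injective (fun k : 'I_#|{set 'I_n * 'I_n}|.+1 => F k).
  move=> k m /= e; apply: val_inj; have lt_neq p q : (p < q)%N -> F p <> F q.
    by move=> /dec; rewrite /total => + e'; rewrite e' ltxx.
  by case: (ltngtP k m) => // /lt_neq; rewrite e.
by have := leq_card _ inj; rewrite card_ord ltnn.
Qed.

(** * Rate of convergence *)

Section Rate.
Variables (b beta k_opt : nat).
Hypothesis b_gt0 : (0 < b)%N.
Hypothesis hit0_le : forall i, live i -> hit (fragile I) i <= b%:R.
Hypothesis den : forall X i, good X -> live i -> exists d z : int,
  [/\ 0 < d, d <= (2 ^ beta)%N%:Z & d%:~R * hit X i = z%:~R].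
Hypothesis opt : terminates_at R I k_opt.

Local Notation opth i := (hit (F k_opt) i).
Local Notation N := (n * b)%N.

(** The run is compared with its own limit: [k_opt] is a termination time on which no bound is
    assumed, and the rate of convergence to its hitting times then gives the bound. *)
Lemma opt_le X i : good X -> live i -> opth i <= hit X i.
Proof.
move=> gX li; rewrite -lee_fin -!hitting_time_hit //; last exact: good_iterate.
apply: fixpoint_le (good_iterate _) (terminates_fixpoint opt) gX.1.
Qed.

Lemma nb_gt0 : (0 < N)%N. Proof. by rewrite muln_gt0 (instance_gt0 I). Qed.

Lemma deg_le X i : (deg I X i <= n)%N.
Proof. by rewrite -[leqRHS]card_ord max_card. Qed.

(* One pass does at least as well as one step of value iteration for the
   optimal configuration. The optimal hitting times serve as weights:
   that step contracts the weighted maximum norm. *)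
Lemma contraction X c : good X -> 0 <= c ->
  (forall i, live i -> hit X i - opth i <= c * opth i) ->
  forall i, live i -> hit (next X) i - opth i <= c * (1 - N%:R^-1) * opth i.
Proof.
move=> gX c0 hc i li; set Y := F k_opt.
have gY : good Y := good_iterate k_opt.
have [dY _ _] := hitting_time_fin (gY.2 i li).
set d : R := (deg I (fragile I) i)%:R.
have d0 : 0 < d by rewrite ltr0n.
rewrite -(ler_pM2l d0) mulrBr.
have e := mixed_sum_hit gY li; rewrite -/d in e.
(* The unit cost of each present arc cancels in the difference and is not scaled by c. At least one
   arc is present, while the whole mixed sum is at most n b: this is the relative gain 1/(n b). *)
have le1 : mixed_sum Y (hit X) i - mixed_sum Y (hit Y) i <=
    c * (mixed_sum Y (hit Y) i - (deg I Y i)%:R).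
  rewrite /mixed_sum -sumrB -[(deg I Y i)%:R]mulr1 -succ_const.
  have -> : \sum_(j | (i, j) \in present I Y) (1 : R) =
      \sum_(j | (i, j) \in edges I) if (i, j) \in present I Y then 1 else 0.
    rewrite -big_mkcondr; apply: eq_bigl => j.
    by case: (boolP (_ \in present I Y)) => [/(fintype.subsetP (present_sub gY.1)) ->|_];
      rewrite ?andbF.
  rewrite -sumrB mulr_sumr; apply: ler_sum => j _.
  case: ifP => _; last by rewrite subr0; apply: hc.
  have : rem_at I (hit X) j - rem_at I (hit Y) j <= c * rem_at I (hit Y) j.
    by rewrite /rem_at; case: (eqVneq j v) => [_|/live_neq/hc //]; rewrite mulr0 subrr.
  lra.
have le2 := hit_next_le_mixed gX gY.1 li; rewrite -/d in le2.
have hN : d * hit Y i <= N%:R.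
  rewrite natrM; apply: ler_pM; rewrite ?hit_ge0 ?ler_nat ?deg_le //.
  exact: le_trans (hit_iterate_le (leq0n k_opt) li) (hit0_le li).
have hN1 : d * hit Y i * N%:R^-1 <= (deg I Y i)%:R.
  rewrite ler_pdivrMr ?ltr0n ?nb_gt0 //; apply: le_trans hN _.
  by rewrite ler_peMl // ler1n.
have : c * (d * hit Y i * N%:R^-1) <= c * (deg I Y i)%:R by apply: ler_wpM2l.
rewrite e in le1; lra.
Qed.

Lemma iterate_rate k i : live i ->
  hit (F k) i - opth i <= b%:R * (1 - N%:R^-1) ^+ k * opth i.
Proof.
have r0 : 0 <= 1 - N%:R^-1 :> R.
  by rewrite subr_ge0 invf_le1 ?ler1n ?ltr0n ?nb_gt0.
elim: k i => [|k IH] i li.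
  (* The initial relative error is at most b because the initial hitting times are at most b and the
     optimal ones at least 1. *)
  have h0 := hit0_le li; rewrite expr0 mulr1.
  have h1 : 1 <= opth i by apply: hit_ge1; apply: (good_iterate k_opt).2.
  have b0 : 0 <= b%:R :> R by [].
  by rewrite -[F 0]/(fragile I); nra.
rewrite exprSr mulrA; apply: (contraction (good_iterate k)) => //.
by rewrite mulr_ge0 // exprn_ge0.
Qed.

(** (1 - 1/N)^N <= 1/2: its product with (1 + 1/N)^N is at most 1, and (1 + 1/N)^N >= 2 by
    Bernoulli's inequality. *)
Lemma half_pow m : (1 - N%:R^-1) ^+ (N * m) <= (2 ^ m)%:R^-1 :> R.
Proof.
have N0 : 0 < N%:R :> R by rewrite ltr0n nb_gt0.
have r0 : 0 <= 1 - N%:R^-1 :> R by rewrite subr_ge0 invf_le1 // ler1n nb_gt0.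
have r1 : 0 <= N%:R^-1 :> R by rewrite invr_ge0 ltW.
rewrite exprM natrX -exprVn; apply: lerXn2r; rewrite ?nnegrE ?exprn_ge0 //.
have le1 : (1 - N%:R^-1) ^+ N * (1 + N%:R^-1) ^+ N <= 1 :> R.
  rewrite -exprMn; move: r0 r1; move: (N%:R^-1 : R) => y r0 r1.
  by apply: exprn_ile1; nra.
have bern m' : 1 + m'%:R * N%:R^-1 <= (1 + N%:R^-1) ^+ m' :> R.
  elim: m' => [|k IH]; first by rewrite mul0r addr0.
  rewrite exprS -natr1 mulrDl mul1r.
  have : 0 <= k%:R * N%:R^-1 :> R by rewrite mulr_ge0.
  nra.
have := bern N; rewrite mulfV ?gt_eqF // => ge2.
have := exprn_ge0 N r0; nra.
Qed.

(** Fractions with denominators at most D = 2^beta that differ by less than 1/D^2 are equal. Every N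
    passes halve the error bound, which starts at b * b: 2 b halvings absorb b * b <= 2^b * 2^b, 2
    beta more reach 1/D^2, and the last one makes the inequality strict. *)
Lemma iterate_optimal i : live i ->
  hit (F (N * (2 * beta + 2 * b + 1))%N) i = opth i.
Proof.
move=> li; set k := (N * _)%N; apply/eqP; rewrite -subr_eq0.
have [d1 [z1 [d1p d1M e1]]] := den (good_iterate k) li.
have [d2 [z2 [d2p d2M e2]]] := den (good_iterate k_opt) li.
have ge0 : 0 <= hit (F k) i - opth i by rewrite subr_ge0 opt_le //; apply: good_iterate.
pose D : R := (2 ^ beta)%:R.
have D0 : 0 < D by rewrite ltr0n expn_gt0.
have lt1 : D * D * (hit (F k) i - opth i) < 1.
  have hb : opth i <= b%:R.
    exact: le_trans (hit_iterate_le (leq0n k_opt) li) (hit0_le li).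
  have := iterate_rate k li; have := half_pow (2 * beta + 2 * b + 1)%N.
  rewrite -/k; set q := (1 - _) ^+ k; set m := (_ + 1)%N => q_le le1.
  have b2 : b%:R <= (2 ^ b)%:R :> R by rewrite ler_nat ltnW // ltn_expl.
  have hp : 0 < (2 ^ b)%:R :> R by rewrite ltr0n expn_gt0.
  have mE : (2 ^ m)%:R = 2 * (D * (2 ^ b)%:R) ^+ 2 :> R.
    have -> : (2 ^ m = 2 * (2 ^ beta * 2 ^ b) ^ 2)%N.
      by rewrite /m addn1 expnS expnMn -!expnM -expnD mulnC [(b * 2)%N]mulnC [(beta *
        2)%N]mulnC mulnC.
    by rewrite natrM natrX natrM.
  have h0 : 0 <= opth i by apply: hit_ge0.
  have : hit (F k) i - opth i <= (2 ^ b)%:R * (2 ^ m)%:R^-1 * (2 ^ b)%:R.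
    apply: le_trans le1 _; rewrite ler_pM // ?mulr_ge0 ?ler_pM ?(le_trans hb) //.
    - rewrite exprn_ge0 // subr_ge0 invf_le1 ?ler1n ?ltr0n ?nb_gt0 //.
    - rewrite exprn_ge0 // subr_ge0 invf_le1 ?ler1n ?ltr0n ?nb_gt0 //.
  rewrite mE => le2.
  have : D * D * (hit (F k) i - opth i) <= 2^-1.
    apply: le_trans (ler_wpM2l _ le2) _; first by rewrite mulr_ge0 ?ltW.
    rewrite le_eqVlt; apply/orP; left; apply/eqP; field.
    by rewrite !gt_eqF.
  by move=> /le_lt_trans; apply; lra.
have : d1%:~R * d2%:~R * (hit (F k) i - opth i) = (z1 * d2 - z2 * d1)%:~R :> R.
  by rewrite intrB !intrM -e1 -e2; ring.
set z : int := z1 * d2 - _ => ez.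
have d1R : 0 < d1%:~R :> R by rewrite ltr0z.
have d2R : 0 < d2%:~R :> R by rewrite ltr0z.
have d1D : d1%:~R <= D by rewrite /D pmulrn ler_int.
have d2D : d2%:~R <= D by rewrite /D pmulrn ler_int.
have z1' : z%:~R < 1 :> R.
  rewrite -ez; apply: le_lt_trans lt1; rewrite ler_wpM2r // ler_pM // ltW //.
have z0' : 0 <= z%:~R :> R by rewrite -ez !mulr_ge0 // ltW.
have z0 : z = 0.
  by apply/eqP; rewrite eq_le; rewrite ler0z in z0'; rewrite z0' andbT -ltzD1 add0r -(ltr_int R).
move/eqP: ez; rewrite z0 mulf_eq0 => /orP[|/eqP->//].
by rewrite gt_eqF // mulr_gt0.
Qed.

(** Optimal hitting times persist. Equal hitting times after m and m + 1 passes give equal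
    configurations after m + 1 and m + 2 passes, hence the final + 2. *)
Lemma terminates_fast :
  exists2 k, terminates_at R I k & (k <= N * (2 * beta + 2 * b + 1) + 2)%N.
Proof.
set m := (N * _)%N; apply: first_termination; rewrite addn2 //=.
apply: hit_eq_next (good_iterate m) (good_iterate m.+1) _ => i li.
apply/eqP; rewrite eq_le; apply/andP; split; last exact: hit_iterate_le.
by rewrite /m iterate_optimal // opt_le //; apply: good_iterate.
Qed.

End Rate.

End Run.
End Live.
End PolicyIteration.

(** * Fraction-free elimination *)

Section Bareiss.
Variables (T : idomainType) (m : nat) (Z : 'M[T]_m.+1).

(* The matrix obtained from the identity by replacing its first k columns by
   those of Z; its adjugate turns the first k columns of Z into multiples of
   unit vectors, as k steps of Gauss-Jordan elimination do. *)
Definition partial_mx k : 'M[T]_m.+1 :=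
  \matrix_(i, j) if (j < k)%N then Z i j else (i == j)%:R.
Definition elim_mx k : 'M[T]_m.+1 := \adj (partial_mx k) *m Z.

Local Notation E := partial_mx.
Local Notation M := elim_mx.
Local Notation D k := (\det (E k)).

Lemma elim_mx_done k (i j : 'I_m.+1) : (j < k)%N -> M k i j = D k *+ (i == j).
Proof.
move=> jk; have <- : (\adj (E k) *m E k) i j = D k *+ (i == j) by rewrite mul_adj_mx mxE.
by rewrite !mxE; apply: eq_bigr => l _; rewrite [E k l j]mxE jk.
Qed.

(** Expansion along column k, the only column in which [E k] and [E k.+1] differ. So the determinant
    by which step k divides is the pivot of the preceding step. *)
Lemma elim_mx_pivot (k : 'I_m.+1) : M k k k = D k.+1.
Proof.
rewrite (expand_det_col _ k) mxE; apply: eq_bigr => i _.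
rewrite mxE [E _ i k]mxE ltnS leqnn mulrC; congr (_ * (_ * \det _)).
apply/matrixP => a b; rewrite !mxE [in RHS]ltnS [in RHS]leq_eqVlt.
by have /negPf -> : bump k b != k by rewrite eq_sym neq_bump.
Qed.

(** Bareiss' identity. [E k.+1] is a rank-one update of [E k], from which [E k.+1] times the
    right-hand side W is a multiple of Z; multiplying by the adjugate and cancelling [D k.+1] gives
    the claim. For i = k the right-hand side is [D k * M k k j], so one formula also covers the
    pivot row, which stays as it is. *)
Lemma elim_mx_step (k : 'I_m.+1) i j : D k.+1 != 0 ->
  D k * M k.+1 i j = M k k k * M k i j - (M k i k - D k *+ (i == k)) * M k k j.
Proof.
move=> D0; set a := M k k k.
pose e : 'cV[T]_m.+1 := delta_mx k 0; pose u := M k *m e; pose r := e^T *m M k.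
pose W := a *: M k - (u - D k *: e) *m r.
have eTe : e^T *m e = 1%:M.
  by rewrite trmx_delta mul_delta_mx; apply/matrixP => x y; rewrite !mxE !ord1 !eqxx.
have eTu : e^T *m u = a%:M.
  rewrite /u mulmxA trmx_delta -rowE -colE; apply/matrixP => x y.
  by rewrite !mxE !ord1 eqxx mulr1n /a mxE.
have EM : E k *m M k = D k *: Z by rewrite mulmxA mul_mx_adj mul_scalar_mx.
have Ee : E k *m e = e.
  rewrite -colE; apply/matrixP => x y; rewrite !mxE ltnn ord1.
  by rewrite eqxx andbT.
have EE : E k.+1 = E k + (Z *m e - e) *m e^T.
  apply/matrixP => x y; rewrite mulmxBl -mulmxA /e trmx_delta mul_delta_mx !mxE ltnS.
  rewrite (bigD1 k) //= big1 => [|l lk]; last by rewrite mxE (negPf lk) mulr0.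
  rewrite mxE eqxx addr0 leq_eqVlt -[y == k]val_eqE /=.
  case: (ltngtP y k) => yk /=; rewrite ?andbF ?mulr0 ?subr0 ?addr0 //.
  by rewrite (val_inj yk) andbT mulr1 addrC subrK.
have EW : E k *m W = (a * D k) *: Z - D k *: ((Z *m e - e) *m r).
  rewrite mulmxBr -scalemxAr EM scalerA [E k *m (_ *m r)]mulmxA mulmxBr.
  rewrite /u [E k *m (M k *m e)]mulmxA EM -scalemxAr Ee.
  by rewrite -scalemxAl -scalerBr -scalemxAl.
have eW : e^T *m W = D k *: r.
  rewrite mulmxBr -scalemxAr -/r mulmxA mulmxBr eTu -scalemxAr eTe.
  by rewrite mulmxBl mul_scalar_mx -scalemxAl mul1mx opprB addrC subrK.
have W_eq : E k.+1 *m W = (a * D k) *: Z.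
  by rewrite EE [LHS]mulmxDl EW -mulmxA eW -scalemxAr subrK.
have : D k.+1 *: (D k *: M k.+1) = D k.+1 *: W.
  rewrite -[RHS]mul_scalar_mx -mul_adj_mx -mulmxA W_eq /M -scalemxAr /a elim_mx_pivot.
  by rewrite scalerA.
move=> /matrixP /(_ i j); rewrite mxE [RHS]mxE => /(mulfI D0).
rewrite mxE => ->; rewrite /W /r trmx_delta -rowE /u -colE !mxE big_ord1 !mxE !eqxx.
by rewrite andbT mulr_natr.
Qed.
End Bareiss.

(** Scaled by rho, the rows of the block are strictly diagonally dominant. In a kernel vector u,
    take the row a < k with the largest |u_a| / rho_a: if u_a were nonzero, the diagonal term would
    outweigh all others. The remaining entries of u then vanish because the other columns are unit
    vectors. *)
Lemma partial_mx_nonsingular (R : realFieldType) m (Z : 'M[int]_m.+1) K (rho : 'I_m.+1 -> R) :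
  (forall i j : 'I_m.+1, (i < K)%N -> (j < K)%N -> i != j -> Z i j <= 0) ->
  (forall j : 'I_m.+1, (j < K)%N -> 0 < rho j) ->
  (forall i : 'I_m.+1, (i < K)%N -> 0 < \sum_(j : 'I_m.+1 | (j < K)%N) (Z i j)%:~R * rho j) ->
  forall k, (k <= K)%N -> \det (partial_mx Z k) != 0.
Proof.
move=> Z_le0 rho0 Zrho k kK; rewrite -det_tr; apply/negP => /det0P[u u0 uE].
have {}uE (i : 'I_m.+1) : \sum_(j : 'I_m.+1 | (j < k)%N) Z i j * u 0 j
    + (if (i < k)%N then 0 else u 0 i) = 0.
  move/matrixP/(_ 0 i): uE; rewrite !mxE => uEi; rewrite -[RHS]uEi.
  rewrite [RHS](bigID (fun j : 'I_m.+1 => (j < k)%N)) /=; congr (_ + _).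
    by apply: eq_bigr => j jk; rewrite !mxE jk mulrC.
  have offdiag : forall j : 'I_m.+1, ~~ (j < k)%N ->
    u 0 j * ((partial_mx Z k)^T) j i = u 0 j *+ (i == j).
    by move=> j /negPf jk; rewrite !mxE jk mulr_natr.
  rewrite (eq_bigr _ offdiag); case: ifP => ik.
    by rewrite big1 // => j; case: eqP => // <-; rewrite ik.
  rewrite (bigD1 i) ?ik //= eqxx big1 ?addr0 // => j /andP[_ ji].
  by rewrite eq_sym (negPf ji).
have head0 (i : 'I_m.+1) : (i < k)%N -> u 0 i = 0.
  move=> ik; apply/eqP/negP => /negP ui.
  pose q (j : 'I_m.+1) : R := `|(u 0 j)%:~R| / rho j.
  have [/= a ak maxa] := @arg_maxP _ _ _ i (fun j : 'I_m.+1 => (j < k)%N) q ik.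
  have rho_k (j : 'I_m.+1) : (j < k)%N -> 0 < rho j by move=> jk; apply/rho0/(leq_trans jk).
  have qa : 0 < q a.
    apply: lt_le_trans (maxa i ik).
    by rewrite divr_gt0 ?rho_k // normr_gt0 intr_eq0.
  have u_le (j : 'I_m.+1) : (j < k)%N -> `|(u 0 j)%:~R| <= q a * rho j.
    by move=> jk; rewrite -ler_pdivrMr ?rho_k //; apply: maxa.
  have ua : `|(u 0 a)%:~R| = q a * rho a by rewrite /q divfK // gt_eqF ?rho_k.
  have aK : (a < K)%N := leq_trans ak kK.
  have := Zrho a aK; rewrite (bigD1 a) //=.
  set S := \sum_(j | _) _ => S0.
  (* The discarded terms are off-diagonal, hence nonpositive: positivity of the weighted row sums
     passes from the block K to the smaller block k. *)
  have S_le : S <= \sum_(j : 'I_m.+1 | (j < k)%N && (j != a)) (Z a j)%:~R * rho j.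
    rewrite /S (bigID (fun j : 'I_m.+1 => (j < k)%N)) /=.
    rewrite (eq_bigl (fun j : 'I_m.+1 => (j < k)%N && (j != a))); last first.
      move=> j; case: (ltnP j k) => [jk|]; last by rewrite andbF.
      by rewrite (leq_trans jk kK) andbT.
    rewrite gerDl.
    apply: sumr_le0 => j /andP[/andP[jK ja] _].
    by apply: mulr_le0_ge0; [rewrite lerz0 Z_le0 // eq_sym | rewrite ltW ?rho0].
  have := uE a; rewrite ak addr0 (bigD1 a) //= => /eqP.
  rewrite addr_eq0 => /eqP /(congr1 (fun z : int => `|z%:~R : R|)).
  rewrite intrM normrM ua intrN normrN => e.
  have : `|(\sum_(j : 'I_m.+1 | (j < k)%N && (j != a)) Z a j * u 0 j)%:~R| <= q a * - S.
    apply: (@le_trans _ _ (q a * \sum_(j : 'I_m.+1 | (j < k)%N && (j != a)) - ((Z a j)%:~R *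
      rho j))); last first.
      by rewrite sumrN ler_wpM2l ?(ltW qa) // lerN2.
    rewrite rmorph_sum mulr_sumr; apply: le_trans (ler_norm_sum _ _ _) _.
    apply: ler_sum => j /andP[jk ja]; rewrite rmorphM /= normrM.
    have Zj : (Z a j)%:~R <= 0 :> R.
      by rewrite lerz0 Z_le0 ?(leq_trans jk) // eq_sym.
    by rewrite (ler0_norm Zj) -mulNr mulrCA ler_wpM2l ?u_le // oppr_ge0.
  rewrite -e; have := ler_norm ((Z a a)%:~R : R); have := rho_k a ak => ra ge_norm le1.
  have : q a * ((Z a a)%:~R * rho a + S) <= 0.
    have : q a * rho a * ((Z a a)%:~R : R) <= q a * rho a * `|(Z a a)%:~R|.
      by apply: ler_wpM2l => //; rewrite mulr_ge0 ?ltW.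
    by rewrite mulrDr; lra.
  by rewrite leNgt mulr_gt0.
suff u_0 : u = 0 by rewrite u_0 eqxx in u0.
apply/matrixP => x i; rewrite ord1 [RHS]mxE.
case: (ltnP i k) => ik; first exact: head0.
have := uE i; rewrite ltnNge ik /= big1 ?add0r // => j jk.
by rewrite head0 ?mulr0.
Qed.

Lemma det_le m (A : 'M[int]_m) (b : nat) : (forall i j, `|A i j| <= b%:Z) ->
  `|\det A| <= (m`! * b ^ m)%N%:Z.
Proof.
move=> Ab; apply: le_trans (ler_norm_sum _ _ _) _.
apply: (@le_trans _ _ (\sum_(s : 'S_m) (b ^ m)%N%:Z)); last first.
  by rewrite sumr_const card_Sn -mulr_natl natz PoszM.
apply: ler_sum => s _; rewrite normrM normrX normrN1 expr1n mul1r normr_prod.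
apply: (@le_trans _ _ (\prod_(i < m) b%:Z)); first by apply: ler_prod => i _;
  rewrite normr_ge0 Ab.
by rewrite prodr_const card_ord -[(b ^ m)%N%:Z]natz natrX natz.
Qed.

(** Leibniz' formula bounds a cofactor by m! (m+1)^m; summing m+1 products with entries of Z gives
    at most (m+1)^(2(m+1)), and m+1 <= 2^(m+1). *)
Lemma elim_mx_le m (Z : 'M[int]_m.+1) k i j : (forall i j, `|Z i j| <= m.+1%:Z) ->
  `|elim_mx Z k i j| <= (2 ^ (2 * m.+1 ^ 2))%N%:Z.
Proof.
move=> Zm; rewrite mxE; apply: le_trans (ler_norm_sum _ _ _) _.
have cof l : `|\adj (partial_mx Z k) i l| <= (m.+1 ^ m * m.+1 ^ m)%N%:Z.
  rewrite mxE /cofactor normrM normrX normrN1 expr1n mul1r.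
  apply: (@le_trans _ _ (m`! * m.+1 ^ m)%N%:Z).
    apply: det_le => x y; rewrite !mxE; case: ifP => _; first exact: Zm.
    by case: eqP.
  rewrite lez_nat leq_mul2r expn_eq0 /=.
  elim: (m) => // p IH; rewrite factS expnS leq_mul //.
  by apply: leq_trans IH _; case: p => // p; rewrite leq_exp2r.
apply: (@le_trans _ _ (\sum_(l < m.+1) (m.+1 ^ m * m.+1 ^ m * m.+1)%N%:Z)).
  by apply: ler_sum => l _; rewrite normrM PoszM ler_pM.
rewrite sumr_const card_ord -mulr_natl natz -PoszM lez_nat.
have -> : (m.+1 * (m.+1 ^ m * m.+1 ^ m * m.+1) = m.+1 ^ (2 * m.+1))%N.
  by rewrite -expnD -expnSr -expnS; congr (_ ^ _)%N; lia.
have -> : (2 ^ (2 * m.+1 ^ 2) = (2 ^ m.+1) ^ (2 * m.+1))%N.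
  by rewrite -expnM; congr (_ ^ _)%N; rewrite -mulnn mulnCA.
by rewrite leq_exp2r // ltnW // ltn_expl.
Qed.

(** Indices are natural numbers, without arcs out of range, because the system and its tables have
    an additional row and column n. *)
Definition has_arc n (S : {set 'I_n * 'I_n}) (i j : nat) : bool :=
  [exists e in S, (e.1 == i :> nat) && (e.2 == j :> nat)].

Lemma has_arcE n (S : {set 'I_n * 'I_n}) (i j : 'I_n) : has_arc S i j = ((i, j) \in S).
Proof.
apply/exists_inP/idP => [[[a b] abS /= /andP[/eqP ai /eqP bj]]|ijS].
  by rewrite -(val_inj ai) -(val_inj bj).
by exists (i, j); rewrite //= !eqxx.
Qed.

Lemma has_arc_out n (S : {set 'I_n * 'I_n}) i j :
  (n <= i)%N || (n <= j)%N -> has_arc S i j = false.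
Proof.
move=> out; apply/exists_inP => -[[a b] _ /= /andP[/eqP ai /eqP bj]].
by move: out; rewrite -ai -bj leqNgt ltn_ord leqNgt ltn_ord.
Qed.

(** * The linear system for the hitting times *)

Section System.
Variables (R : realType) (n : nat) (I : instance n) (X : {set 'I_n * 'I_n}).
Local Notation v := (target I).
Local Notation hit := (finite_hit R I X).
Local Notation arc i j := (has_arc (present I X) i j : nat).
Local Notation N := n.+1.

Definition out_arcs i : nat := \sum_(0 <= j < N) arc i j.

Lemma out_arcs_sum (V : nmodType) (i : 'I_n) (G : nat -> V) :
  \sum_(0 <= j < N) G j *+ arc i j = \sum_(j | (i, j) \in present I X) G j.
Proof.
rewrite big_mkord big_ord_recr /=.
rewrite has_arc_out ?leqnn ?orbT // addr0 [RHS]big_mkcond; apply: eq_bigr => j _ /=.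
by rewrite has_arcE; case: ifP.
Qed.

Lemma out_arcsE (i : 'I_n) : out_arcs i = deg I X i.
Proof.
rewrite /deg -sum1dep_card /out_arcs.
rewrite -(@out_arcs_sum nat i (fun=> 1%N)).
by apply: eq_bigr => j _; case: (has_arc _ _ _).
Qed.

(* Row i < n, i <> v, encodes deg h_i - (sum of h_j over the arcs (i, j)) = deg, with h_v =
  0 given by
   row v; column n holds the right-hand sides. *)
Definition system (i j : nat) : int :=
  if (i == v :> nat) || (i == n) then (i == j)%:R
  else (out_arcs i)%:Z *+ ((i == j) + (j == n)) - (arc i j)%:Z.

Definition system_mx : 'M[int]_N := \matrix_(i, j) system i j.

Lemma out_arcs_le i : (out_arcs i <= n)%N.
Proof.
rewrite /out_arcs big_nat_recr //=.
rewrite has_arc_out ?leqnn ?orbT // addn0 -[leqRHS]muln1 -[X in (_ <= X * _)%N]subn0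
  -sum_nat_const_nat.
by apply: leq_sum => j _; case: has_arc.
Qed.

Lemma system_le i j : `|system_mx i j| <= N%:Z.
Proof.
rewrite mxE /system; case: ifPn => [_|]; first by case: eqP.
have dn := out_arcs_le i.
have arc1 : (arc i j <= 1)%N by case: has_arc.
have [-> | jn] := eqVneq (j : nat) n.
  by move=> /norP[_ /negPf ->]; rewrite has_arc_out ?leqnn ?orbT // mulr1n subr0; lia.
by move=> _; case: eqP => _; rewrite ?mulr1n ?mulr0n; lia.
Qed.

Hypothesis live_neq : forall i, i != v -> live I i.
Hypothesis goodX : good R I X.

Let w : 'I_n -> 'I_N := widen_ord (leqnSn n).

(** Weights for [partial_mx_nonsingular]: the hitting times, except at v, where the remaining time 0
    must be replaced by something positive. Each arc contributes 1 to a row sum in excess of the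
    weights, so a weight below 1 at v keeps the row sums positive. *)
Let rho (j : 'I_N) : R := if insub (j : nat) is Some j' then
  if j' == v then 2^-1 else hit j' else 1.

Lemma rhoE (j : 'I_n) : rho (w j) = rem_at I hit j + 2^-1 *+ (j == v).
Proof.
rewrite /rho /w /= valK /rem_at; case: eqP; rewrite ?add0r ?addr0 //.
Qed.

Lemma deg_gt0 i : live I i -> (0 < deg I X i)%N.
Proof. by case: goodX => _ gX /gX /hitting_time_fin[]. Qed.

Lemma succ_sum_hit i : live I i -> succ_sum I X hit i = (deg I X i)%:R * hit i.
Proof. by case: goodX => _ gX /gX /hitting_time_fin[]. Qed.

Lemma system_row (i : 'I_n) (y : 'I_n -> R) : i != v ->
  \sum_(j < n) (system i j)%:~R * y j =
  (deg I X i)%:R * y i - \sum_(j | (i, j) \in present I X) y j.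
Proof.
move=> iv; have iv' : (i == v :> nat) = false by apply/negbTE.
rewrite /system iv' ltn_eqF //= out_arcsE.
have -> : (deg I X i)%:R * y i = \sum_(j < n) (deg I X i)%:R * y j *+ (i == j :> nat).
  rewrite (bigD1 i) //= eqxx big1 ?addr0 // => j ji.
  by rewrite eq_sym (negPf (ji : (j != i :> nat))).
rewrite [X in _ - X]big_mkcond -sumrB; apply: eq_bigr => j _.
rewrite (ltn_eqF (ltn_ord j)) addn0 has_arcE intrB mulrBl; congr (_ - _).
  by case: eqP => _; rewrite ?mulr1n ?mulr0n ?mul0r.
by case: (_ \in _); rewrite ?mul1r ?mul0r.
Qed.

Local Notation Delta := (\det (partial_mx system_mx n)).

Lemma system_nonsingular k : (k <= n)%N -> \det (partial_mx system_mx k) != 0.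
Proof.
have fin i : live I i -> 1 <= hit i by case: goodX => _ gX /gX /hit_ge1.
have wP (j : 'I_N) : (j < n)%N -> exists j', j = w j'.
  by move=> jn; exists (Ordinal jn); apply: val_inj.
have rho0 (j : 'I_n) : 0 < rho (w j).
  rewrite rhoE /rem_at; case: (eqVneq j v) => [_|jv]; first by rewrite add0r invr_gt0.
  by rewrite mulr0n addr0 (lt_le_trans _ (fin j (live_neq jv))).
apply: (@partial_mx_nonsingular R _ _ _ rho) =>
  [i j /wP[{}i ->] /wP[{}j ->] ij|j /wP[{}j ->] //|i /wP[{}i ->]].
  rewrite mxE /system /= (negPf (ij : (i != j :> nat))) (ltn_eqF (ltn_ord j)) mulr0n sub0r.
  by case: ifP.
rewrite big_mkcond big_ord_recr /= ltnn addr0.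
under eq_bigr => j _ do rewrite ltn_ord mxE /=.
have [iv|iv] := eqVneq i v.
  rewrite (bigD1 i) //= big1 => [|j ji]; last first.
    by rewrite /system iv eqxx /= eq_sym -iv (negPf (ji : (j != i :> nat))) mul0r.
  by rewrite /system iv !eqxx mul1r addr0.
rewrite system_row // rhoE (negPf iv) mulr0n addr0 {1}/rem_at (negPf iv).
have d0 := deg_gt0 (live_neq iv).
rewrite -succ_sum_hit ?live_neq // -sumrB.
apply: (@lt_le_trans _ _ (\sum_(j | (i, j) \in present I X) 2^-1)).
  by rewrite succ_const mulr_gt0 ?ltr0n ?invr_gt0.
by apply: ler_sum => j _; rewrite rhoE; case: (j == v); rewrite ?mulr1n ?mulr0n; lra.
Qed.

(** Append -1 to the remaining times. The system maps this vector y to zero except in the padding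
    row n, and row [w i] of the adjugate vanishes in column n. So [elim_mx] annihilates y in row
    [w i], where its first n columns are the determinant times the identity. *)
Lemma system_solution (i : 'I_n) :
  Delta%:~R * rem_at I hit i = (elim_mx system_mx n (w i) ord_max)%:~R :> R.
Proof.
pose y (j : 'I_N) : R := if insub (j : nat) is Some j' then rem_at I hit j' else -1.
have yE (j : 'I_n) : y (w j) = rem_at I hit j by rewrite /y /w /= valK.
have ymax : y ord_max = -1 by rewrite /y insubF // ltnn.
have Zy l : \sum_j (system_mx l j)%:~R * y j = - (l == ord_max)%:R.
  rewrite big_ord_recr /= ymax mulrN1 mxE; under eq_bigr do rewrite mxE.
  case: (unliftP ord_max l) => [l'|] -> /=; last first.
    rewrite /system eqxx orbT big1 => [|j _]; first by rewrite eqxx sub0r.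
    by rewrite gtn_eqF ?mul0r // ltn_ord.
  rewrite [_ == ord_max]eq_sym (negPf (neq_lift _ _)) oppr0 /bump leqNgt ltn_ord add0n.
  under eq_bigr do rewrite yE.
  have [lv|lv] := eqVneq l' v.
    rewrite (bigD1 l') //= big1 => [|j jl]; last first.
      by rewrite /system lv eqxx /= eq_sym -lv (negPf (jl : (j != l' :> nat))) mul0r.
    rewrite /system lv !eqxx mul1r addr0 /rem_at eqxx ltn_eqF ?ltn_ord //.
    by rewrite subr0.
  rewrite system_row // {1}/rem_at (negPf lv) -succ_sum_hit ?live_neq // -sumrB.
  rewrite /system (negPf (lv : (l' != v :> nat))) !(ltn_eqF (ltn_ord l')) /= eqxx.
  rewrite has_arc_out ?leqnn ?orbT // subr0 add0n mulr1n out_arcsE.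
  by under eq_bigr do rewrite addrK; rewrite succ_const mulr1 subrr.
have : \sum_j (elim_mx system_mx n (w i) j)%:~R * y j = 0.
  transitivity (\sum_l (\adj (partial_mx system_mx n) (w i) l)%:~R *
      (\sum_j (system_mx l j)%:~R * y j)).
    under [RHS]eq_bigr do rewrite mulr_sumr.
    rewrite exchange_big /=; apply: eq_bigr => j _.
    rewrite mxE rmorph_sum mulr_suml; apply: eq_bigr => l _.
    by rewrite rmorphM mulrA.
  under eq_bigr do rewrite Zy.
  rewrite big_ord_recr /= eqxx big1 => [|j _]; last first.
    by rewrite -val_eqE /= ltn_eqF ?ltn_ord // oppr0 mulr0.
  have : (\adj (partial_mx system_mx n) *m partial_mx system_mx n) (w i) ord_max = 0.
    by rewrite mul_adj_mx mxE -val_eqE /= ltn_eqF ?ltn_ord.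
  rewrite mxE big_ord_recr /= big1 => [|j _]; last first.
    by rewrite [partial_mx _ _ _ _]mxE /= ltnn -val_eqE /= ltn_eqF ?ltn_ord // mulr0.
  rewrite [partial_mx _ _ _ _]mxE /= ltnn eqxx mulr1 !add0r => ->.
  by rewrite mul0r.
rewrite big_ord_recr /= ymax mulrN1 => /eqP; rewrite subr_eq0 => /eqP <-.
rewrite (bigD1 i) //= big1 => [|j ji]; last first.
  by rewrite elim_mx_done /= ?ltn_ord // -val_eqE /= eq_sym (negPf (ji : (j != i :> nat))) mul0r.
by rewrite elim_mx_done /= ?ltn_ord // eqxx mulr1n addr0 yE.
Qed.

End System.

(** * Costs of programs *)

Declare Scope expr_scope.
Delimit Scope expr_scope with X.
Bind Scope expr_scope with expr.
Notation "e1 + e2" := (Add e1 e2) : expr_scope.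
Notation "e1 - e2" := (Defs.Sub e1 e2) : expr_scope.
Notation "e1 * e2" := (Mul e1 e2) : expr_scope.
Notation "e1 / e2" := (Div e1 e2) : expr_scope.

Definition mod_expr (e1 e2 : expr) : expr := (e1 - (e1 / e2) * e2)%X.

(* For integers a and b, 1 / (1 + (a - b)^2) rounds down to [a = b], and
   1 + z / (z^2 + 1) to [0 <= z]. *)
Definition eq_expr (e1 e2 : expr) : expr :=
  (Const 1 / (Const 1 + (e1 - e2) * (e1 - e2)))%X.
Definition nonneg_expr (e : expr) : expr := (Const 1 + e / (e * e + Const 1))%X.
Definition not_expr (e : expr) : expr := (Const 1 - e)%X.

(** Only constants and cells read are bounded by B. Intermediate values may be larger; [weight] is
    the exponent of the power of B that bounds them. *)
Fixpoint reads_le (B : nat) (s : store) (e : expr) : bool :=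
  match e with
  | Const z => (`|z| <= B)%N
  | Read a e1 => reads_le B s e1 && (`|s a (Defs.eval s e1)| <= B)%N
  | Add e1 e2 | Defs.Sub e1 e2 | Mul e1 e2 | Div e1 e2 =>
      reads_le B s e1 && reads_le B s e2
  end.

Fixpoint weight (e : expr) : nat :=
  match e with
  | Const _ | Read _ _ => 1
  | Add e1 e2 | Defs.Sub e1 e2 | Mul e1 e2 | Div e1 e2 => weight e1 + weight e2
  end.

(** Coefficient of beta^2 in the cost, for B = 2^beta. It depends on the syntax alone, which keeps
    the final polynomial independent of the instance. *)
Fixpoint cost_factor (e : expr) : nat :=
  match e with
  | Const z => 2
  | Read a e1 => cost_factor e1 + 2 * weight e1 + 2
  | Add e1 e2 | Defs.Sub e1 e2 =>
      cost_factor e1 + cost_factor e2 + 2 * weight e1 + 2 * weight e2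
  | Mul e1 e2 | Div e1 e2 =>
      cost_factor e1 + cost_factor e2 + (2 * weight e1) * (2 * weight e2)
  end.

Lemma weight_gt0 e : (0 < weight e)%N.
Proof. by elim: e => //= e1 IH1 e2 IH2; rewrite addn_gt0 IH1. Qed.

Section Evaluation.
Variable beta : nat.
Local Notation B := (2 ^ beta)%N.
Implicit Types (s : store) (e : expr).

Definition ev s e z : Prop := Defs.eval s e = z /\ reads_le B s e.

Lemma ev_eq s e z z' : ev s e z -> z = z' -> ev s e z'.
Proof. by move=> ? <-. Qed.

Lemma ev_const s z : (`|z| <= B)%N -> ev s (Const z) z.
Proof. by []. Qed.

Lemma ev_read s a e p z : ev s e p -> s a p = z -> (`|z| <= B)%N -> ev s (Read a e) z.
Proof. by case=> <- re <- zB; split=> //=; rewrite re. Qed.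

Lemma ev_add s e1 e2 x y : ev s e1 x -> ev s e2 y -> ev s (e1 + e2)%X (x + y).
Proof. by case=> <- r1 [<- r2]; split=> //=; rewrite r1. Qed.

Lemma ev_sub s e1 e2 x y : ev s e1 x -> ev s e2 y -> ev s (e1 - e2)%X (x - y).
Proof. by case=> <- r1 [<- r2]; split=> //=; rewrite r1. Qed.

Lemma ev_mul s e1 e2 x y : ev s e1 x -> ev s e2 y -> ev s (e1 * e2)%X (x * y).
Proof. by case=> <- r1 [<- r2]; split=> //=; rewrite r1. Qed.

Lemma ev_div s e1 e2 x y : ev s e1 x -> ev s e2 y -> ev s (e1 / e2)%X (x %/ y)%Z.
Proof. by case=> <- r1 [<- r2]; split=> //=; rewrite r1. Qed.

Lemma ev1 s : ev s (Const 1) 1.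
Proof. by apply: ev_const; rewrite expn_gt0. Qed.

Lemma ev_eqe s e1 e2 x y : ev s e1 x -> ev s e2 y -> ev s (eq_expr e1 e2) (x == y)%:Z.
Proof.
move=> h1 h2; have hs := ev_sub h1 h2.
apply: ev_eq (ev_div (ev1 s) (ev_add (ev1 s) (ev_mul hs hs))) _.
have [->|xy] := eqVneq x y; first by rewrite subrr mulr0 addr0 divz1.
rewrite divz_small //=; move/eqP: xy => xy; nia.
Qed.

Lemma ev_nonneg s e x : ev s e x -> ev s (nonneg_expr e) (0 <= x)%R%:Z.
Proof.
move=> h; apply: ev_eq (ev_add (ev1 s) (ev_div h (ev_add (ev_mul h h) (ev1 s)))) _.
have p : 0 < x * x + 1 by nia.
case: leP => x0; first by rewrite divz_small // x0 (gtz0_abs p); nia.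
have -> : (x %/ (x * x + 1))%Z = -1; last by [].
have lo := lez_floor x (lt0r_neq0 p); have hi := ltz_ceil x p; nia.
Qed.

Lemma ev_not s e (b : bool) : ev s e b%:Z -> ev s (not_expr e) (~~ b)%:Z.
Proof. by move=> h; apply: ev_eq (ev_sub (ev1 s) h) _; case: b {h}. Qed.

Lemma ev_addn s e1 e2 (x y : nat) : ev s e1 x%:Z -> ev s e2 y%:Z -> ev s (e1 + e2)%X (x + y)%N%:Z.
Proof. exact: ev_add. Qed.

Lemma ev_subn s e1 e2 (x y : nat) : (y <= x)%N ->
  ev s e1 x%:Z -> ev s e2 y%:Z -> ev s (e1 - e2)%X (x - y)%N%:Z.
Proof. by move=> yx h1 h2; rewrite -subzn //; apply: ev_sub. Qed.

Lemma ev_muln s e1 e2 (x y : nat) : ev s e1 x%:Z -> ev s e2 y%:Z -> ev s (e1 * e2)%X (x * y)%N%:Z.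
Proof. by rewrite PoszM; apply: ev_mul. Qed.

Lemma ev_divn s e1 e2 (x y : nat) : ev s e1 x%:Z -> ev s e2 y%:Z ->
  ev s (e1 / e2)%X (x %/ y)%N%:Z.
Proof. by rewrite -divz_nat; apply: ev_div. Qed.

Lemma ev_modn s e1 e2 (x y : nat) : ev s e1 x%:Z -> ev s e2 y%:Z ->
  ev s (mod_expr e1 e2) (x %% y)%N%:Z.
Proof.
move=> h1 h2; have h := ev_sub h1 (ev_muln (ev_divn h1 h2) h2).
by apply: ev_eq h _; rewrite {1}(divn_eq x y) PoszD addrAC subrr add0r.
Qed.

End Evaluation.
Arguments ev1 {beta} s.

Section Cost.
Variable beta : nat.
Hypothesis beta_gt0 : (0 < beta)%N.
Local Notation B := (2 ^ beta)%N.
Implicit Types (s : store) (e : expr).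

Local Notation ev := (ev beta).

Lemma eval_le s e : reads_le B s e -> (`|Defs.eval s e| <= B ^ weight e)%N.
Proof.
have B2 : (1 < B)%N by rewrite -{1}(expn0 2) ltn_exp2l.
have pow_ge1 m : (0 < B ^ m)%N by rewrite expn_gt0 ltnW.
have sum_le x y m p : (0 < m)%N -> (0 < p)%N -> (x <= B ^ m)%N -> (y <= B ^ p)%N ->
    (x + y <= B ^ (m + p))%N.
  move=> m0 p0 xm yp; rewrite expnD.
  have ge2 q : (0 < q)%N -> (1 < B ^ q)%N.
    by move=> q0; rewrite -{1}(expn0 B) ltn_exp2l.
  have := ge2 m m0; have := ge2 p p0; nia.
elim: e => [z|a e IH|e1 IH1 e2 IH2|e1 IH1 e2 IH2|e1 IH1 e2 IH2|e1 IH1 e2 IH2] /=.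
- by rewrite expn1.
- by case/andP=> _; rewrite expn1.
- case/andP=> /IH1 le1 /IH2 le2.
  by apply: leq_trans (sum_le _ _ _ _ _ _ le1 le2); rewrite ?weight_gt0 //; lia.
- case/andP=> /IH1 le1 /IH2 le2.
  by apply: leq_trans (sum_le _ _ _ _ _ _ le1 le2); rewrite ?weight_gt0 //; lia.
- by case/andP=> /IH1 le1 /IH2 le2; rewrite abszM expnD leq_mul.
- case/andP=> /IH1 le1 _; apply: leq_trans (lez_div _ _) _; apply: leq_trans le1 _.
  by rewrite expnD leq_pmulr.
Qed.

Lemma bits_le s e : reads_le B s e -> (bits (Defs.eval s e) <= 2 * weight e * beta)%N.
Proof.
move=> /eval_le le_e; rewrite /bits.
apply: (@leq_ltn_trans (trunc_log 2 (2 ^ (beta * weight e)))).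
  by apply: leq_trunc_log; rewrite expnM.
by rewrite trunc_expnK //; have := weight_gt0 e; nia.
Qed.

Lemma eval_cost_le s e : reads_le B s e -> (eval_cost s e <= cost_factor e * beta ^ 2)%N.
Proof.
have lin w : (2 * w * beta <= 2 * w * beta ^ 2)%N by nia.
elim: e => [z|a e IH|e1 IH1 e2 IH2|e1 IH1 e2 IH2|e1 IH1 e2 IH2|e1 IH1 e2 IH2] /=.
- by move=> zB; have := @bits_le (fun _ _ => 0) (Const z) zB; have := lin 1%N => /=; lia.
- case/andP=> re sB; have := IH re; have := bits_le re; have := lin (weight e).
  have := @bits_le (fun _ _ => 0) (Const (s a (Defs.eval s e))) sB; have := lin 1%N => /=; lia.
- case/andP=> r1 r2; have := IH1 r1; have := IH2 r2; have := bits_le r1; have := bits_le r2.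
  have := lin (weight e1); have := lin (weight e2); lia.
- case/andP=> r1 r2; have := IH1 r1; have := IH2 r2; have := bits_le r1; have := bits_le r2.
  have := lin (weight e1); have := lin (weight e2); lia.
- case/andP=> r1 r2; have := IH1 r1; have := IH2 r2.
  by have := leq_mul (bits_le r1) (bits_le r2); rewrite mulnACA mulnn; lia.
- case/andP=> r1 r2; have := IH1 r1; have := IH2 r2.
  by have := leq_mul (bits_le r1) (bits_le r2); rewrite mulnACA mulnn; lia.
Qed.

Definition write_factor e1 e2 : nat :=
  cost_factor e1 + cost_factor e2 + 2 * weight e1 + 2 * weight e2.

Lemma exec_write_ev a e1 e2 s p z : ev s e1 p -> ev s e2 z ->
  exists2 t, exec (Write a e1 e2) s t (update s a p z)
    & (t <= write_factor e1 e2 * beta ^ 2)%N.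
Proof.
case=> <- r1 [<- r2]; eexists; first exact: exec_write.
have := eval_cost_le r1; have := eval_cost_le r2; have := bits_le r1; have := bits_le r2.
rewrite /write_factor; nia.
Qed.

Definition arr_counter : nat := 7.
Definition counter : expr := Read arr_counter (Const 0).

Definition fill_body a e : cmd :=
  Seq (Write a counter e) (Write arr_counter (Const 0) (counter + Const 1)%X).
Definition fill a lo hi e : cmd :=
  Seq (Write arr_counter (Const 0) lo) (While (hi - counter)%X (fill_body a e)).

Definition test_factor e : nat := cost_factor e + 2 * weight e.
Definition pass_factor hi e : nat :=
  test_factor (hi - counter)%X + write_factor counter e
  + write_factor (Const 0) (counter + Const 1)%X.
Definition fill_factor lo hi e : nat :=
  write_factor (Const 0) lo + pass_factor hi e + test_factor (hi - counter)%X.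

(** Loop invariant of [fill]. Keeping the cells below l allows a table to be continued from an
    initial part computed otherwise, as for prefix sums and for the elimination. *)
Definition filled s a l c (f : nat -> int) s' : Prop :=
  [/\ forall b p, b != a -> b != arr_counter -> s' b p = s b p,
      forall c', (c' < l)%N -> s' a c'%:Z = s a c'%:Z,
      forall c', (l <= c' < c)%N -> s' a c'%:Z = f c'
    & s' arr_counter 0 = c%:Z].

Lemma ev_test s e z : ev s e z ->
  (eval_cost s e + bits (Defs.eval s e) <= test_factor e * beta ^ 2)%N.
Proof.
case=> _ r; have := eval_cost_le r; have := bits_le r; rewrite /test_factor; nia.
Qed.

(** The values of hi and e are required only in states satisfying the invariant, so e may read the
    cells of a written before: tables may be defined recursively. *)
Lemma exec_fill a l h lo hi e s f : a != arr_counter -> (l <= h)%N -> (h <= B)%N ->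
  ev s lo l%:Z ->
  (forall c s', (l <= c <= h)%N -> filled s a l c f s' ->
     ev s' hi h%:Z /\ ((c < h)%N -> ev s' e (f c))) ->
  exists t s', [/\ exec (fill a lo hi e) s t s', filled s a l h f s'
    & (t <= fill_factor lo hi e * h.+1 * beta ^ 2)%N].
Proof.
move=> ac lh hB evlo step.
have ev0 s' : ev s' (Const 0) 0 by apply: ev_const.
have loop d : forall c s', (h - c)%N = d -> (l <= c <= h)%N -> filled s a l c f s' ->
    exists t s'', [/\ exec (While (hi - counter)%X (fill_body a e)) s' t s'',
      filled s a l h f s''
      & (t <= (d * pass_factor hi e + test_factor (hi - counter)%X) * beta ^ 2)%N].
  elim: d => [|d IH] c s' hc lch fl; have [lc ch] := andP lch;
    have [evhi eve] := step c s' lch fl.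
    have ec : c = h by apply/eqP; rewrite eqn_leq ch -subn_eq0 hc.
    have [_ _ _ cnt] := fl.
    have evc : ev s' counter c%:Z by apply: ev_read (ev0 _) cnt _; rewrite ec.
    have evt := ev_sub evhi evc.
    eexists; exists s'; split; last 1 first.
    - by rewrite mul0n add0n; apply: ev_test evt.
    - by apply: exec_while_stop; rewrite (proj1 evt) ec subrr.
    - by rewrite -ec.
  have lt_ch : (c < h)%N by rewrite -subn_gt0 hc.
  have [fr frl frf cnt] := fl.
  have evc : ev s' counter c%:Z by apply: ev_read (ev0 _) cnt _; rewrite (leq_trans ch hB).
  have evt := ev_sub evhi evc.
  have [t1 ex1 le1] := exec_write_ev a evc (eve lt_ch).
  set s1 := update s' a c%:Z (f c) in ex1.
  have cnt1 : s1 arr_counter 0 = c%:Z by rewrite /s1 /update eq_sym (negPf ac).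
  have evc1 : ev s1 (counter + Const 1)%X (c + 1)%N%:Z.
    apply: ev_addn (ev1 _); apply: ev_read (ev0 _) cnt1 _.
    by rewrite (leq_trans ch hB).
  have [t2 ex2 le2] := exec_write_ev arr_counter (ev0 s1) evc1.
  set s2 := update s1 _ _ _ in ex2.
  have fl2 : filled s a l c.+1 f s2.
    rewrite /s2 /s1 /update; split.
    - by move=> b p ba bc; rewrite (negPf ba) (negPf bc) fr.
    - move=> c' c'l; rewrite (negPf ac) eqxx /= eqz_nat ltn_eqF ?frl //.
      exact: leq_trans c'l lc.
    - move=> c' /andP[lc' c'c]; rewrite (negPf ac) eqxx /= eqz_nat.
      by case: eqP => [->//|/eqP cc']; apply: frf; rewrite lc' ltn_neqAle cc'.
    - by rewrite !eqxx addn1.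
  have [||t3 [s3 [ex3 fl3 le3]]] := IH c.+1 s2 _ _ fl2.
  - by rewrite subnS hc.
  - by rewrite (leq_trans lc) // lt_ch.
  have lt0 : 0 < Defs.eval s' (hi - counter)%X by rewrite (proj1 evt) subr_gt0 ltz_nat.
  eexists; exists s3; split; first exact: exec_while_step lt0 (exec_seq ex1 ex2) ex3.
    exact: fl3.
  have passE : (pass_factor hi e * beta ^ 2 = test_factor (hi - counter)%X * beta ^ 2
      + write_factor counter e * beta ^ 2
      + write_factor (Const 0) (counter + Const 1)%X * beta ^ 2)%N by rewrite -!mulnDl.
  move: le3 (ev_test evt) le1 le2 passE; rewrite mulSn !mulnDl.
  lia.
have [t0 ex0 le0] := exec_write_ev arr_counter (ev0 s) evlo.
have [||t [s' [ex fl le]]] := loop (h - l)%N l (update s arr_counter 0 l%:Z) erefl.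
- by rewrite leqnn lh.
- rewrite /filled /update; split=> //.
  + by move=> b p _ /negPf ->.
  + by move=> c' _; rewrite (negPf ac).
  + by move=> c' /andP[lc']; rewrite ltnNge lc'.
exists (t0 + t)%N, s'; split=> //; first exact: exec_seq ex0 ex.
rewrite /fill_factor; have : (h - l <= h)%N by rewrite leq_subr.
have : (0 < h.+1)%N by [].
move: le le0; set b2 := (beta ^ 2)%N; move: (write_factor _ _) (pass_factor _ _) (test_factor _).
by move=> w p q; rewrite !mulnDl; nia.
Qed.

End Cost.

(** * A program for one pass *)

Lemma cell_div m i j : (j < m)%N -> ((i * m + j) %/ m = i)%N.
Proof. by move=> jm; rewrite divnMDl ?(leq_trans _ jm) // divn_small ?addn0. Qed.

Lemma cell_mod m i j : (j < m)%N -> ((i * m + j) %% m = j)%N.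
Proof. by move=> jm; rewrite modnMDl modn_small. Qed.

Lemma cell_lt m p i j : (i < p)%N -> (j < m)%N -> (i * m + j < p * m)%N.
Proof. by move=> ip jm; apply: leq_trans (_ : i.+1 * m <= _)%N;
  rewrite ?leq_mul2r ?ip ?orbT // mulSn addnC ltn_add2r. Qed.

(** Row sums become differences of two cells of a prefix-sum table, so that no loop has to be nested
    inside [fill]. *)
Lemma prefix_row (V : zmodType) (f : nat -> V) m i :
  \sum_(0 <= c < i.+1 * m) f c - \sum_(0 <= c < i * m) f c =
  \sum_(0 <= j < m) f (i * m + j)%N.
Proof.
rewrite (@big_cat_nat _ _ _ (i * m)) //= ?leq_mul2r ?leqnSn ?orbT // addrAC subrr add0r.
by rewrite -{1}[(i * m)%N]add0n big_addn mulSn addnK; apply: eq_bigr => j _; rewrite addnC.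
Qed.

Definition arr_arc : nat := 8.
Definition arr_arc_sum : nat := 9.
Definition arr_elim : nat := 10.
Definition arr_weight : nat := 11.
Definition arr_weight_sum : nat := 12.
Definition arr_next : nat := 13.
Definition arr_diff_sum : nat := 14.

Definition nodes : expr := Read arr_params (Const 0).
Definition target_node : expr := Read arr_params (Const 1).
Definition stride : expr := (nodes + Const 1)%X.

(** In the padding row and column n, [valid] is 0: it redirects the reads to the legal address 0 and
    annuls the result. Elsewhere edges - fragile + configuration is the bit of [fixed I :|: X],
    because X is contained in [fragile I] and [fragile I] in [edges I]. *)
Definition arc_expr : expr :=
  let i := (counter / stride)%X in
  let j := mod_expr counter stride in
  let valid := (not_expr (eq_expr i nodes) * not_expr (eq_expr j nodes))%X in
  let p := ((i * nodes + j) * valid)%X in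
  (valid * (Read arr_edges p - Read arr_fragile p + Read arr_config p))%X.

Definition prefix_sum (a : nat) (hi e : expr) : cmd :=
  Seq (Write a (Const 0) (Const 0))
    (fill a (Const 1) hi (Read a (counter - Const 1) + e)%X).

Definition out_arcs_expr (i : expr) : expr :=
  (Read arr_arc_sum ((i + Const 1) * stride) - Read arr_arc_sum (i * stride))%X.

Definition system_expr : expr :=
  let i := (counter / stride)%X in
  let j := mod_expr counter stride in
  let unit_row := (eq_expr i target_node + eq_expr i nodes)%X in
  (unit_row * eq_expr i j + not_expr unit_row *
    ((eq_expr i j + eq_expr j nodes) * out_arcs_expr i - Read arr_arc counter))%X.

Definition elim_expr (k i j : expr) : expr :=
  Read arr_elim ((k * stride + i) * stride + j)%X.

(* Writes step k + 1.  The pivot, i.e. the determinant to divide by, is found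
   in step k - 1, except that it is 1 for k = 0; replacing k - 1 by k.-1 keeps
   the address of the unused read legal in that case. *)
Definition elim_step_expr : expr :=
  let j := mod_expr counter stride in
  let i := mod_expr (counter / stride)%X stride in
  let k := (counter / stride / stride - Const 1)%X in
  let start := eq_expr k (Const 0) in
  let k' := (k - not_expr start)%X in
  let pivot := (start + not_expr start * elim_expr k' k' k')%X in
  ((elim_expr k k k * elim_expr k i j
     - (elim_expr k i k - eq_expr i k * pivot) * elim_expr k k j) / pivot)%X.

(** After n steps each of the first n diagonal entries equals the determinant; the entry (0, 0) is
    among them as n > 0. *)
Definition det_expr : expr := elim_expr nodes (Const 0) (Const 0).

(* Multiples of 1 + rem_at by the square of the determinant, whose sign thus
   need not be known. *)
Definition weight_expr : expr := (det_expr * (det_expr + elim_expr nodes counter nodes))%X.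

Definition weight_sum_expr : expr :=
  (Read arr_arc (counter - Const 1) *
    Read arr_weight (mod_expr (counter - Const 1) stride))%X.

(* The last term turns the 0/0 of a node without outgoing arcs into the
   encoding 1/0 of an infinite hitting time. *)
Definition num_expr : expr :=
  (Read arr_weight_sum ((counter + Const 1) * stride)
    - Read arr_weight_sum (counter * stride)
    + eq_expr (out_arcs_expr counter) (Const 0))%X.

Definition den_expr : expr := (det_expr * det_expr * out_arcs_expr counter)%X.

(** The test [1 + rem_at j <= hit i] cleared of denominators: multiplied by the squared determinant
    and the out-degree of i, its sides become weight times out-degree and num. *)
Definition next_expr : expr :=
  let i := (counter / nodes)%X in
  let j := mod_expr counter nodes in
  (Read arr_fragile counter *
    nonneg_expr (Read arr_num i - Read arr_weight j * out_arcs_expr i))%X.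

Definition diff_sum_expr : expr :=
  let d := (Read arr_next (counter - Const 1) - Read arr_config (counter - Const 1))%X in
  (d * d)%X.

Definition changed_expr : expr :=
  not_expr (eq_expr (Read arr_diff_sum (nodes * nodes)%X) (Const 0)).

(** * Contents of the arrays and correctness of the expressions *)

Section Pass.
Variables (R : realType) (n : nat) (I : instance n) (X : {set 'I_n * 'I_n}).
Local Notation v := (target I).
Local Notation N := n.+1.
Hypothesis live_neq : forall i, i != v -> live I i.
Hypothesis goodX : good R I X.

Definition elim_val k i j : int := elim_mx (system_mx I X) k (inord i) (inord j).
Definition det_val : int := elim_val n 0 0.
Definition weight_val j : int := det_val * (det_val + elim_val n j n).
Definition arc_val c : int := has_arc (present I X) (c %/ N) (c %% N).
Definition cell_val (S : {set 'I_n * 'I_n}) c : int := has_arc S (c %/ n) (c %% n).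
Definition weight_sum_val c : int := \sum_(0 <= b < c) arc_val b * weight_val (b %% N).
Definition num_val i : int :=
  weight_sum_val (i.+1 * N) - weight_sum_val (i * N) + (out_arcs I X i == 0%N).
Definition den_val i : int := det_val * det_val * (out_arcs I X i)%:Z.
Definition diff_val c : int :=
  cell_val (next_config R I X) c - cell_val X c.

(** The cases are the array numbers. [arr_changed] and [arr_counter] get size 0, as single cells
    that are treated apart. *)
Definition table_size (a : nat) : nat :=
  match a with
  | 0 => 2
  | 1 | 2 | 3 | 13 => n * n
  | 4 | 5 => n
  | 8 => N * N
  | 9 | 12 => (N * N).+1
  | 10 => N * N * N
  | 11 => N
  | 14 => (n * n).+1
  | _ => 0
  end.

Definition table (a c : nat) : int :=
  match a with
  | 0 => if c == 0%N then n%:Z else (v : nat)%:Z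
  | 1 => cell_val (edges I) c
  | 2 => cell_val (fragile I) c
  | 3 => cell_val X c
  | 4 => num_val c
  | 5 => den_val c
  | 8 => arc_val c
  | 9 => \sum_(0 <= b < c) arc_val b
  | 10 => elim_val (c %/ N %/ N) (c %/ N %% N) (c %% N)
  | 11 => weight_val c
  | 12 => weight_sum_val c
  | 13 => cell_val (next_config R I X) c
  | 14 => \sum_(0 <= b < c) diff_val b * diff_val b
  | _ => 0
  end.

(** With q = 2^(N^2), entries of the elimination are at most q^2, the weights at most 2 q^4, and the
    numerators combine at most 4 q weights; q^8 bounds all of these. *)
Definition word_size : nat := 8 * N ^ 2.
Local Notation B := (2 ^ word_size)%N.

Lemma pow_size : (N * N <= 2 ^ (N ^ 2))%N.
Proof. by rewrite -mulnn ltnW // ltn_expl. Qed.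

Lemma table_size_lt a : (table_size a < (N * N * N).+2)%N.
Proof. by have := instance_gt0 I; do 15?[case: a => [|a] /=]; nia. Qed.

Lemma size_le : ((N * N * N).+2 <= B)%N.
Proof.
have p := pow_size; have -> : B = ((2 ^ (N ^ 2)) ^ 8)%N by rewrite -expnM mulnC.
set q := (2 ^ (N ^ 2))%N in p *; have q4 : (4 <= N * N)%N by have := instance_gt0 I; nia.
apply: (@leq_trans (2 * q ^ 2)%N); first by rewrite !expnS expn0; nia.
apply: (@leq_trans (q * q ^ 2)%N); first by rewrite leq_mul //; lia.
by rewrite -expnS leq_pexp2l //; lia.
Qed.

Lemma table_size_le a : (table_size a <= B)%N.
Proof. exact: leq_trans (ltnW (table_size_lt a)) size_le. Qed.

Lemma elim_val_le k i j : (`|elim_val k i j| <= 2 ^ (2 * N ^ 2))%N.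
Proof.
have := @elim_mx_le n (system_mx I X) k (inord i) (inord j) (@system_le n I X).
by rewrite /elim_val; lia.
Qed.

Lemma absz_sum_le (f : nat -> int) m (b : nat) :
  (forall c, absz (f c) <= b)%N -> (absz (\sum_(0 <= c < m) f c)%R <= m * b)%N.
Proof.
move=> fb; elim: m => [|m IH]; first by rewrite big_geq.
rewrite big_nat_recr //= mulSn; have := fb m.
by move: (\sum_(0 <= _ < m) _) IH (f m) => x + y; lia.
Qed.

Local Notation q := (2 ^ N ^ 2)%N.

Lemma weight_val_le j : (`|weight_val j| <= 2 * q ^ 4)%N.
Proof.
have := elim_val_le n 0 0; have := elim_val_le n j n.
rewrite /weight_val /det_val mulnC expnM abszM.
have -> : (q ^ 4 = q ^ 2 * q ^ 2)%N by rewrite -expnD.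
move: (q ^ 2)%N => p; nia.
Qed.

Lemma arc_val_le c : (`|arc_val c| <= 1)%N.
Proof. by rewrite /arc_val; case: has_arc. Qed.

Lemma cell_val_le S c : (`|cell_val S c| <= 1)%N.
Proof. by rewrite /cell_val; case: has_arc. Qed.

Lemma weight_sum_val_le c : (`|weight_sum_val c| <= c * (2 * q ^ 4))%N.
Proof.
apply: absz_sum_le => b; rewrite abszM -[leqRHS]mul1n.
by apply: leq_mul; [apply: arc_val_le | apply: weight_val_le].
Qed.

Lemma table_le a c : (c < table_size a)%N -> (`|table a c| <= B)%N.
Proof.
have BE : B = (q ^ 8)%N by rewrite -expnM mulnC.
have p := pow_size; have sB := size_le; have n0 := instance_gt0 I.
have q4 : (4 <= q)%N by apply: leq_trans p; nia.
have q1 m : (0 < q ^ m)%N by rewrite expn_gt0; lia.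
have small x : (x <= N * N * N)%N -> (x <= B)%N by lia.
have bit (b : bool) : (`|(b : nat)%:Z| <= B)%N by apply: small; case: b; nia.
have big_le x m : (x <= m * (2 * q ^ 4))%N -> (m <= 4 * q)%N -> (x.+1 <= B)%N.
  move=> xm mq; rewrite BE; apply: (@leq_trans (q ^ 7)%N); last by rewrite leq_pexp2l //; lia.
  have -> : (q ^ 7 = q * q * q * q ^ 4)%N by rewrite -mulnn -!mulnA -!expnS.
  apply: (@leq_trans (4 * q * (2 * q ^ 4)).+1); first by rewrite ltnS (leq_trans xm) // leq_mul.
  have := q1 4%N; move: (q ^ 4)%N q4 => r; move: q => u u4 r0.
  have u16 : (16 <= u * u)%N by nia.
  have ur : (0 < u * r)%N by rewrite muln_gt0 r0; lia.
  by have := leq_mul u16 (leqnn (u * r)); lia.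
have Bq2 : (q ^ 2 <= B)%N by rewrite BE leq_pexp2l //; lia.
do 15?[case: a => [|a]] => //=.
- by move=> _; case: ifP => _; apply: small; have := ltn_ord v; nia.
- by move=> _; apply: bit.
- by move=> _; apply: bit.
- by move=> _; apply: bit.
- move=> cn; rewrite /num_val.
  have h : (`|weight_sum_val (c.+1 * N)| + `|weight_sum_val (c * N)| < B)%N.
    apply: (big_le _ (c.+1 * N + c * N)%N); last by nia.
    by rewrite mulnDl leq_add ?weight_sum_val_le.
  move: (weight_sum_val _) (weight_sum_val _) (out_arcs _ _ _ == _) B h => x y e b.
  by case: e; lia.
- move=> cn; rewrite /den_val !abszM.
  have := elim_val_le n 0 0; rewrite /det_val [(2 * _)%N]mulnC expnM => e.
  have o := out_arcs_le I X c.
  apply: (@leq_trans (q ^ 2 * q ^ 2 * q)%N).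
    by apply: leq_mul; [apply: leq_mul | rewrite absz_nat; nia].
  by rewrite -expnD -expnSr BE leq_pexp2l //; lia.
- by move=> _; apply: bit.
- move=> cN; apply: leq_trans (absz_sum_le _ arc_val_le) _.
  by apply: small; nia.
- move=> _; apply: leq_trans (elim_val_le _ _ _) _.
  by rewrite [(2 * _)%N]mulnC expnM.
- move=> _; apply: leq_trans (weight_val_le _) _; apply: ltnW.
  by apply: (big_le _ 1%N); lia.
- move=> cN; apply: leq_trans (weight_sum_val_le _) _; apply: ltnW.
  by apply: (big_le _ c) => //; lia.
- by move=> _; apply: bit.
- move=> cN; apply: leq_trans (absz_sum_le (b := 1) _ _) _; last by apply: small; nia.
  by move=> b; rewrite /diff_val /cell_val; case: has_arc; case: has_arc.
Qed.

Lemma word_size_gt0 : (0 < word_size)%N. Proof. by []. Qed.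

Local Notation ev := (ev word_size).

Definition holds_vals (L : seq nat) (s : store) : Prop :=
  forall a, a \in L -> forall c, (c < table_size a)%N -> s a c%:Z = table a c.

(** The unit of cost dominates the number of cells of every table times the squared word size, so
    the cost of a sequence is a sum of purely syntactic factors. *)
Definition run (c : cmd) (s s' : store) (F : nat) : Prop :=
  exists2 t, exec c s t s' & (t <= F * ((N * N * N).+2 * word_size ^ 2))%N.

Lemma run_seq c1 c2 s1 s2 s3 F1 F2 :
  run c1 s1 s2 F1 -> run c2 s2 s3 F2 -> run (Seq c1 c2) s1 s3 (F1 + F2).
Proof.
move=> [t1 e1 le1] [t2 e2 le2]; exists (t1 + t2)%N; first exact: exec_seq e1 e2.
by rewrite mulnDl leq_add.
Qed.

Lemma run_write a e1 e2 s p z : ev s e1 p -> ev s e2 z ->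
  run (Write a e1 e2) s (update s a p z) (write_factor e1 e2).
Proof.
move=> h1 h2; have [t ex le] := exec_write_ev word_size_gt0 a h1 h2; exists t => //.
by apply: leq_trans le _; rewrite leq_mul2l leq_pmull ?orbT.
Qed.

Definition frame a (s s' : store) : Prop :=
  forall b p, b != a -> b != arr_counter -> s' b p = s b p.

Lemma holds_vals_frame L a s s' : frame a s s' ->
  a \notin L -> arr_counter \notin L -> holds_vals L s -> holds_vals L s'.
Proof.
move=> fr aL cL h b bL c cb; rewrite fr ?h //.
  by apply: contraNneq aL => <-.
by apply: contraNneq cL => <-.
Qed.

Lemma run_fill L a l h lo hi e s :
  holds_vals L s -> a \notin L -> arr_counter \notin L -> a != arr_counter ->
  (l <= h <= table_size a)%N -> (forall c, (c < l)%N -> s a c%:Z = table a c) -> ev s lo l%:Z ->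
  (forall s', holds_vals L s' -> ev s' hi h%:Z) ->
  (forall c s', (l <= c < h)%N -> holds_vals L s' ->
     (forall c', (c' < c)%N -> s' a c'%:Z = table a c') ->
     ev s' counter c%:Z -> ev s' e (table a c)) ->
  exists s', [/\ run (fill a lo hi e) s s' (fill_factor lo hi e),
    holds_vals L s', (forall c, (c < h)%N -> s' a c%:Z = table a c) & frame a s s'].
Proof.
move=> hs aL cL ac /andP[lh hl] sl evlo evhi eve.
have filled_vals s' c : filled s a l c (table a) s' -> forall c', (c' < c)%N ->
  s' a c'%:Z = table a c'.
  move=> [fr frl frf _] c' c'c; have [c'l|lc'] := ltnP c' l; first by rewrite frl ?sl.
  by rewrite frf // lc'.
have [|t [s' [ex fl le]]] := exec_fill word_size_gt0 (e := e) (f :=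
  table a) ac lh (leq_trans hl (table_size_le a)) evlo (hi := hi).
  move=> c s' /andP[lc ch] fl; have hs' : holds_vals L s'.
    by have [fr _ _ _] := fl; exact: holds_vals_frame fr aL cL hs.
  split=> [|lt_ch]; first exact: evhi.
  apply: eve; rewrite ?lc //; first exact: filled_vals fl.
  case: fl => _ _ _ cnt; apply: ev_read (ev_const _ _) cnt _ => //.
  exact: (leq_trans (leq_trans ch hl) (table_size_le a)).
exists s'; split; last by case: fl.
- exists t => //; apply: leq_trans le _; rewrite -mulnA leq_mul2l leq_mul2r.
  by rewrite (leq_ltn_trans hl) ?table_size_lt ?orbT.
- by have [fr _ _ _] := fl; exact: holds_vals_frame fr aL cL hs.
- exact: filled_vals fl.
Qed.

Lemma run_table L a l lo hi e s :
  holds_vals L s -> a \notin L -> arr_counter \notin L -> a != arr_counter ->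
  (l <= table_size a)%N -> (forall c, (c < l)%N -> s a c%:Z = table a c) -> ev s lo l%:Z ->
  (forall s', holds_vals L s' -> ev s' hi (table_size a)%:Z) ->
  (forall c s', (l <= c < table_size a)%N -> holds_vals L s' ->
     (forall c', (c' < c)%N -> s' a c'%:Z = table a c') ->
     ev s' counter c%:Z -> ev s' e (table a c)) ->
  exists s', [/\ run (fill a lo hi e) s s' (fill_factor lo hi e),
    holds_vals (a :: L) s' & frame a s s'].
Proof.
move=> hs aL cL ac la sl evlo evhi eve.
have [|s' [rs hs' av fr]] := run_fill hs aL cL ac _ sl evlo evhi eve; first by rewrite la leqnn.
by exists s'; split=> // b; rewrite inE => /predU1P[->|/hs'].
Qed.

Section Expr.
Variables (L : seq nat) (s : store).
Hypothesis sL : holds_vals L s.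

Lemma ev_arr a e (c : nat) : a \in L -> ev s e c%:Z -> (c < table_size a)%N ->
  ev s (Read a e) (table a c).
Proof. by move=> aL he ca; apply: ev_read he (sL aL ca) (table_le ca). Qed.

Lemma ev_self a e (c c' : nat) : (forall c', (c' < c)%N -> s a c'%:Z = table a c') ->
  ev s e c'%:Z -> (c' < c)%N -> (c <= table_size a)%N -> ev s (Read a e) (table a c').
Proof. by move=> sa he c'c ca; apply: ev_read he (sa _ c'c) (table_le (leq_trans c'c ca)). Qed.

Lemma ev0 : ev s (Const 0) 0%N%:Z. Proof. exact: ev_const. Qed.
Lemma ev1n : ev s (Const 1) 1%N%:Z. Proof. exact: ev1. Qed.

Lemma ev_nodes : arr_params \in L -> ev s nodes n%:Z.
Proof. by move=> aL; apply: ev_eq (ev_arr aL ev0 _) _. Qed.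

Lemma ev_target : arr_params \in L -> ev s target_node (v : nat)%:Z.
Proof. by move=> aL; apply: ev_eq (ev_arr aL ev1n _) _. Qed.

Lemma ev_stride : arr_params \in L -> ev s stride N%:Z.
Proof. by move=> aL; apply: ev_eq (ev_addn (ev_nodes aL) ev1n) _; rewrite addn1. Qed.

Lemma ev_eqn e1 e2 (x y : nat) : ev s e1 x%:Z -> ev s e2 y%:Z ->
  ev s (eq_expr e1 e2) (x == y :> nat)%:Z.
Proof. exact: ev_eqe. Qed.

Lemma ev_andb e1 e2 (b1 b2 : bool) : ev s e1 b1%:Z -> ev s e2 b2%:Z ->
  ev s (e1 * e2)%X (b1 && b2)%:Z.
Proof. by move=> h1 h2; apply: ev_eq (ev_mul h1 h2) _; case: b1 {h1}; case: b2 {h2}. Qed.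

Lemma ev_pred e (c : nat) : (0 < c)%N -> ev s e c%:Z -> ev s (e - Const 1)%X c.-1%:Z.
Proof. by move=> c0 he; apply: ev_eq (ev_subn c0 he ev1n) _; rewrite subn1. Qed.

Lemma ev_succ e (c : nat) : ev s e c%:Z -> ev s (e + Const 1)%X c.+1%:Z.
Proof. by move=> he; apply: ev_eq (ev_addn he ev1n) _; rewrite addn1. Qed.

Lemma ev_out_arcs e i : arr_params \in L -> arr_arc_sum \in L -> (i < N)%N ->
  ev s e i%:Z -> ev s (out_arcs_expr e) (out_arcs I X i)%:Z.
Proof.
move=> pL aL iN he; have hN := ev_stride pL.
have lt1 : (i.+1 * N < table_size arr_arc_sum)%N by rewrite ltnS leq_mul2r iN orbT.
have lt2 : (i * N < table_size arr_arc_sum)%N by rewrite ltnS leq_mul2r ltnW ?orbT.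
apply: ev_eq (ev_sub (ev_arr aL (ev_muln (ev_succ he) hN) lt1) (ev_arr aL (ev_muln he hN) lt2)) _.
rewrite prefix_row /out_arcs -[RHS]natz natr_sum; apply: eq_big_nat => j /andP[_ jN].
by rewrite /arc_val cell_div // cell_mod // natz.
Qed.

Lemma ev_elim ek ei ej k i j : arr_params \in L -> arr_elim \in L ->
  (k < N)%N -> (i < N)%N -> (j < N)%N ->
  ev s ek k%:Z -> ev s ei i%:Z -> ev s ej j%:Z -> ev s (elim_expr ek ei ej) (elim_val k i j).
Proof.
move=> pL aL kN iN jN hk hi hj; have hN := ev_stride pL.
apply: ev_eq (ev_arr aL (ev_addn (ev_muln (ev_addn (ev_muln hk hN) hi) hN) hj) _) _.
  by rewrite /= cell_lt ?cell_lt.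
by rewrite /table /arr_elim !cell_div ?cell_mod.
Qed.

Lemma ev_det : arr_params \in L -> arr_elim \in L -> ev s det_expr det_val.
Proof. by move=> pL aL; apply: ev_elim (ev_nodes pL) ev0 ev0. Qed.

End Expr.

Lemma mul_boolz (b : bool) (x : int) : b%:Z * x = x *+ b.
Proof. by case: b; rewrite (mul1r, mul0r). Qed.

Definition inputs : seq nat := [:: arr_params; arr_edges; arr_fragile; arr_config].

Lemma ev_arc_expr s c : holds_vals inputs s -> (c < N * N)%N -> ev s counter c%:Z ->
  ev s arc_expr (arc_val c).
Proof.
move=> hs cN hc; have hn := ev_nodes hs isT; have hN := ev_stride hs isT.
have hi := ev_divn hc hN; have hj := ev_modn hc hN; have nz := instance_gt0 I.
have jN : (c %% N < N)%N by rewrite ltn_pmod.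
have iN : (c %/ N < N)%N by rewrite ltn_divLR.
have hv := ev_andb (ev_not (ev_eqn hi hn)) (ev_not (ev_eqn hj hn)).
have hp := ev_muln (ev_addn (ev_muln hi hn) hj) hv.
move: hv hp; rewrite /arc_val; set i := (c %/ N)%N in hi iN *; set j := (c %% N)%N in hj jN *.
set valid := _ && _ => hv hp.
have pn : ((i * n + j) * valid < n * n)%N.
  rewrite /valid; case: (eqVneq i n) => [_|i_n] /=; first by rewrite muln0 muln_gt0 nz.
  case: (eqVneq j n) => [_|j_n] /=; first by rewrite muln0 muln_gt0 nz.
  by rewrite muln1 cell_lt // ltn_neqAle ?i_n ?j_n.
apply: ev_eq (ev_mul hv (ev_add (ev_sub (ev_arr hs (a := arr_edges) isT hp pn)
  (ev_arr hs (a := arr_fragile) isT hp pn)) (ev_arr hs (a := arr_config) isT hp pn))) _.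
rewrite mul_boolz /= /cell_val /valid; case: (eqVneq i n) => [->|i_n].
  by rewrite [has_arc (present I X) _ _]has_arc_out ?leqnn //= mulr0n.
case: (eqVneq j n) => [->|j_n] /=;
  first by rewrite [has_arc (present I X) _ _]has_arc_out ?leqnn ?orbT // mulr0n.
have in_ : (i < n)%N by rewrite ltn_neqAle i_n.
have jn_ : (j < n)%N by rewrite ltn_neqAle j_n.
rewrite muln1 cell_div // cell_mod //.
rewrite !(has_arcE _ (Ordinal in_) (Ordinal jn_)) mulr1n.
set e := (_, _); rewrite !inE; have [cX _] := goodX.
have := fintype.subsetP (fragile_sub I) e; have := fintype.subsetP cX e.
by case: (e \in X); case: (e \in fragile I); case: (e \in edges I) => //= h1 h2;
  first [by have := h1 isT | by have := h2 isT].
Qed.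

Lemma run_prefix_sum L a hi e s (f : nat -> int) :
  holds_vals L s -> a \notin L -> arr_counter \notin L -> a != arr_counter ->
  (0 < table_size a)%N -> (forall c, table a c = \sum_(0 <= b < c) f b) ->
  (forall s', holds_vals L s' -> ev s' hi (table_size a)%:Z) ->
  (forall c s', (0 < c < table_size a)%N -> holds_vals L s' ->
     ev s' counter c%:Z -> ev s' e (f c.-1)) ->
  exists s', [/\ run (prefix_sum a hi e) s s' (write_factor (Const 0) (Const 0) +
      fill_factor (Const 1) hi (Read a (counter - Const 1) + e)%X),
    holds_vals (a :: L) s' & frame a s s'].
Proof.
move=> hs aL cL ac sz tE evhi eve; pose s1 := update s a 0 0.
have fr1 : frame a s s1 by move=> b q /negPf ba _; rewrite /s1 /update ba.
have hs1 := holds_vals_frame fr1 aL cL hs.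
have [||c s' cb hs' sa hc|s' [rs' hs' fr']] := run_table (l := 1) (lo := Const 1) (hi := hi)
  (e := (Read a (counter - Const 1) + e)%X) hs1 aL cL ac sz _ _ evhi.
- by case=> // _; rewrite tE big_geq // /s1 /update !eqxx.
- exact: ev1n.
- have /andP[c0 ca] := cb; have hp := ev_pred c0 hc.
  apply: ev_eq (ev_add (ev_self sa hp _ (ltnW ca)) (eve c s' cb hs' hc)) _.
    by rewrite ltn_predL.
  by rewrite !tE -[in RHS](prednK c0) big_nat_recr.
exists s'; split=> //; first exact: run_seq (run_write _ (ev0 s) (ev0 s)) rs'.
by move=> b q ba bc; rewrite fr' // fr1.
Qed.

Lemma ev_system_expr s c : holds_vals (arr_arc_sum :: arr_arc :: inputs) s ->
  (c < N * N)%N -> ev s counter c%:Z -> ev s system_expr (table arr_elim c).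
Proof.
move=> hs cN hc; have hn := ev_nodes hs isT; have hN := ev_stride hs isT.
have hi := ev_divn hc hN; have hj := ev_modn hc hN; have ht := ev_target hs isT.
have jN : (c %% N < N)%N by rewrite ltn_pmod.
have iN : (c %/ N < N)%N by rewrite ltn_divLR.
have hA := ev_arr hs (a := arr_arc) isT hc cN.
have hu : ev s (eq_expr (counter / stride) target_node + eq_expr (counter / stride) nodes)%X
    (((c %/ N)%N == v) || ((c %/ N)%N == n))%:Z.
  apply: ev_eq (ev_addn (ev_eqn hi ht) (ev_eqn hi hn)) _.
  by have := ltn_ord v; case: eqP => [->|_]; case: eqP => // ->; rewrite ltnn.
have hd := ev_out_arcs hs (e := (counter / stride)%X) isT isT iN hi.
apply: ev_eq (ev_add (ev_mul hu (ev_eqn hi hj)) (ev_mul (ev_not hu)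
  (ev_sub (ev_mul (ev_addn (ev_eqn hi hj) (ev_eqn hj hn)) hd) hA))) _.
rewrite /= /elim_val [(c %/ N %/ N)%N]divn_small // [(c %/ N %% N)%N]modn_small // /elim_mx.
have -> : partial_mx (system_mx I X) 0 = 1%:M.
  by apply/matrixP => x y; rewrite !mxE ltn0.
rewrite adj1 mul1mx mxE !inordK // /system.
rewrite !mul_boolz.
case: ((_ == _ :> nat) || _) => /=; first by rewrite mulr1n mulr0n addr0 natz.
by rewrite mulr0n add0r mulr1n -mulr_natl natz.
Qed.

Lemma ev_elim_step_expr s c : holds_vals (arr_arc_sum :: arr_arc :: inputs) s ->
  (N * N <= c < N * N * N)%N ->
  (forall c', (c' < c)%N -> s arr_elim c'%:Z = table arr_elim c') ->
  ev s counter c%:Z -> ev s elim_step_expr (table arr_elim c).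
Proof.
move=> hs /andP[Nc cN] sa hc; have hn := ev_nodes hs isT; have hN := ev_stride hs isT.
have hj := ev_modn hc hN; have hi := ev_modn (ev_divn hc hN) hN.
have k0 : (0 < c %/ N %/ N)%N by rewrite -divnMA divn_gt0.
have hk := ev_pred k0 (ev_divn (ev_divn hc hN) hN).
have jN : (c %% N < N)%N by rewrite ltn_pmod.
have iN : (c %/ N %% N < N)%N by rewrite ltn_pmod.
have kN : (c %/ N %/ N < N)%N by rewrite -divnMA ltn_divLR // mulnA.
rewrite /table /arr_elim; set k1 := (c %/ N %/ N)%N in hk k0 kN *.
set i := (c %/ N %% N)%N in hi iN *; set j := (c %% N)%N in hj jN *.
have ek : k1 = k1.-1.+1 by rewrite prednK.
set k := k1.-1 in hk ek *; have kn : (k < n)%N by rewrite -ltnS -ek.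
(* All cells of step k, and of the steps before it, lie below the cell c being written, so they
   already hold their final values. *)
have c_ge : (k.+1 * N * N <= c)%N.
  rewrite -ek /k1 -mulnA -divnMA; exact: leq_trunc_div.
have hread ek' ei ej k' i' j' : (k' <= k)%N -> (i' < N)%N -> (j' < N)%N ->
    ev s ek' k'%:Z -> ev s ei i'%:Z -> ev s ej j'%:Z ->
    ev s (elim_expr ek' ei ej) (elim_val k' i' j').
  move=> k'k i'N j'N hk' hi' hj'.
  apply: ev_eq (ev_self sa (ev_addn (ev_muln (ev_addn (ev_muln hk' hN) hi') hN) hj') _ _) _.
  - by apply: leq_trans c_ge; rewrite cell_lt // cell_lt.
  - exact: ltnW.
  - by rewrite /table /arr_elim !cell_div ?cell_mod.
have kN' : (k < N)%N by rewrite ltnS ltnW.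
have hs0 := ev_eqn hk (ev0 s).
have hk' : ev s (counter / stride / stride - Const 1
    - not_expr (eq_expr (counter / stride / stride - Const 1)%X (Const 0)))%X k.-1%:Z.
  by apply: ev_eq (ev_sub hk (ev_not hs0)) _; case: (k) => [|m] /=; lia.
have kp : (k.-1 <= k)%N by rewrite leq_pred.
have kpN : (k.-1 < N)%N := leq_ltn_trans kp kN'.
have hp : ev s (eq_expr (counter / stride / stride - Const 1)%X (Const 0)
    + not_expr (eq_expr (counter / stride / stride - Const 1)%X (Const 0)) *
      elim_expr (counter / stride / stride - Const 1
        - not_expr (eq_expr (counter / stride / stride - Const 1)%X (Const 0)))
        (counter / stride / stride - Const 1
        - not_expr (eq_expr (counter / stride / stride - Const 1)%X (Const 0)))
        (counter / stride / stride - Const 1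
        - not_expr (eq_expr (counter / stride / stride - Const 1)%X (Const 0))))%X
    (\det (partial_mx (system_mx I X) k)).
  apply: ev_eq (ev_add hs0 (ev_mul (ev_not hs0) (hread _ _ _ _ _ _ kp kpN kpN hk' hk' hk'))) _.
  case ek0 : (k) => [|k'] /=.
    rewrite mul0r addr0; have -> : partial_mx (system_mx I X) 0 = 1%:M.
      by apply/matrixP => x y; rewrite !mxE ltn0.
    by rewrite det1.
  have k'N : (k' < N)%N by rewrite ltnW // -ek0.
  have := elim_mx_pivot (system_mx I X) (inord k' : 'I_N).
  by rewrite add0r mul1r /elim_val inordK // => ->.
have h1 := hread _ _ _ _ _ _ (leqnn k) kN' kN' hk hk hk.
have h2 := hread _ _ _ _ _ _ (leqnn k) iN jN hk hi hj.
have h3 := hread _ _ _ _ _ _ (leqnn k) iN kN' hk hi hk.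
have h4 := hread _ _ _ _ _ _ (leqnn k) kN' jN hk hk hj.
have h5 := ev_sub (ev_mul h1 h2) (ev_mul (ev_sub h3 (ev_mul (ev_eqn hi hk) hp)) h4).
apply: ev_eq (ev_div h5 hp) _.
have D1 := system_nonsingular live_neq goodX (kn : (k.+1 <= n)%N).
have D0 := system_nonsingular live_neq goodX (ltnW kn).
have := @elim_mx_step _ _ (system_mx I X) (inord k) (inord i) (inord j).
rewrite inordK // => /(_ D1) step.
rewrite /elim_val ek; apply: (mulfI D0); rewrite step.
set w := (X in (X %/ _)%Z).
(* The integer division is exact: by [elim_mx_step] the dividend is the divisor times the next
   entry. *)
have -> : w = \det (partial_mx (system_mx I X) k) * elim_mx (system_mx I X) k.+1 (inord i)
  (inord j).
  rewrite step /w -val_eqE /= !inordK // -mulr_natl natz.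
  by congr (_ - (_ - _) * _).
by rewrite mulKz // step.
Qed.

Lemma det_valE : det_val = \det (partial_mx (system_mx I X) n).
Proof.
have nz := instance_gt0 I; rewrite /det_val /elim_val elim_mx_done; first by rewrite eqxx.
by rewrite inordK.
Qed.

Lemma det_val_neq0 : det_val != 0.
Proof. by rewrite det_valE (system_nonsingular live_neq goodX). Qed.

Lemma weight_valE (j : 'I_n) :
  (weight_val j)%:~R = det_val%:~R ^+ 2 * (1 + rem_at I (finite_hit R I X) j) :> R.
Proof.
have sol := system_solution live_neq goodX j; rewrite -det_valE in sol.
have e : (elim_val n j n)%:~R = det_val%:~R * rem_at I (finite_hit R I X) j :> R.
  rewrite sol /elim_val; congr (_%:~R); congr (elim_mx _ _ _ _); apply: val_inj => /=.
    by rewrite inordK // ltnS ltnW.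
  by rewrite inordK.
by rewrite /weight_val intrM intrD e; ring.
Qed.

Lemma num_valE (i : 'I_n) :
  num_val i = \sum_(j | (i, j) \in present I X) weight_val j + (deg I X i == 0%N).
Proof.
rewrite /num_val /weight_sum_val prefix_row out_arcsE -out_arcs_sum; congr (_ + _).
apply: eq_big_nat => j /andP[_ jN].
by rewrite /arc_val cell_div // cell_mod // mul_boolz.
Qed.

Lemma num_live (i : 'I_n) : live I i ->
  (num_val i)%:~R = (den_val i)%:~R * finite_hit R I X i :> R.
Proof.
move=> li; have d0 := deg_gt0 goodX li.
rewrite num_valE gtn_eqF // addr0 rmorph_sum /=.
under eq_bigr do rewrite weight_valE.
rewrite -mulr_sumr -/(succ_sum I X (finite_hit R I X) i) (succ_sum_hit goodX li).
by rewrite /den_val out_arcsE !intrM; ring.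
Qed.

Lemma den_live (i : 'I_n) : live I i -> 0 < den_val i.
Proof.
move=> li; have d0 := deg_gt0 goodX li; have D0 := det_val_neq0.
by rewrite /den_val out_arcsE pmulr_lgt0 ?ltz_nat // -expr2 exprn_even_gt0.
Qed.

Lemma num_den_val (i : 'I_n) : 0 < num_val i /\
  ((hitting_time R I X i)^-1)%E = ((den_val i)%:~R / (num_val i)%:~R)%:E.
Proof.
have [li|li] := boolP (live I i).
  have den0 := den_live li; have eq_num := num_live li.
  have h1 := hit_ge1 (goodX.2 i li).
  have h0 : 0 < finite_hit R I X i := lt_le_trans ltr01 h1.
  have num0 : 0 < num_val i by rewrite -(ltr0z R) eq_num mulr_gt0 // ltr0z.
  split=> //; rewrite (hitting_time_hit goodX li) inver gt_eqF // eq_num.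
  by rewrite invfM mulrA mulfV ?mul1r // intr_eq0 gt_eqF.
have Hy := hitting_time_dead R goodX.1 li.
have d0 : deg I X i = 0%N.
  apply/eqP; rewrite -leqn0 leqNgt; apply/negP => d0; case/negP: li.
  case/card_gt0P: d0 => j; rewrite inE => ij.
  exact: edge_live (fintype.subsetP (present_sub goodX.1) _ ij).
have -> : num_val i = 1.
  rewrite num_valE d0 big1 ?add0r // => j ij.
  suff : (0 < deg I X i)%N by rewrite d0.
  by apply/card_gt0P; exists j; rewrite inE.
split=> //; rewrite Hy invey /den_val out_arcsE d0 mulr0 mul0r //.
Qed.

Lemma ev_weight_expr s c : holds_vals (arr_elim :: arr_arc_sum :: arr_arc :: inputs) s ->
  (c < N)%N -> ev s counter c%:Z -> ev s weight_expr (weight_val c).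
Proof.
move=> hs cN hc; have hn := ev_nodes hs isT; have hd := ev_det hs isT isT.
by apply: ev_mul hd (ev_add hd (ev_elim hs isT isT _ cN _ hn hc hn)).
Qed.

Lemma ev_num_expr s c :
  holds_vals (arr_weight_sum :: arr_weight :: arr_elim :: arr_arc_sum :: arr_arc :: inputs) s ->
  (c < n)%N -> ev s counter c%:Z -> ev s num_expr (num_val c).
Proof.
move=> hs cn hc; have hN := ev_stride hs isT; have cN : (c < N)%N by rewrite ltnS ltnW.
have lt1 : (c.+1 * N < table_size arr_weight_sum)%N by rewrite ltnS leq_mul2r cN orbT.
have lt2 : (c * N < table_size arr_weight_sum)%N by rewrite ltnS leq_mul2r ltnW ?orbT.
apply: ev_add (ev_eqn (ev_out_arcs hs isT isT cN hc) (ev0 s)).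
exact: (ev_sub (ev_arr hs (a := arr_weight_sum) isT (ev_muln (ev_succ hc) hN) lt1)
  (ev_arr hs (a := arr_weight_sum) isT (ev_muln hc hN) lt2)).
Qed.

Lemma ev_den_expr s c :
  holds_vals (arr_num :: arr_weight_sum :: arr_weight :: arr_elim :: arr_arc_sum :: arr_arc
    :: inputs) s ->
  (c < n)%N -> ev s counter c%:Z -> ev s den_expr (den_val c).
Proof.
move=> hs cn hc; have hd := ev_det hs isT isT.
by apply: ev_mul (ev_mul hd hd) (ev_out_arcs hs isT isT _ hc); rewrite ltnS ltnW.
Qed.

Lemma ev_next_expr s c :
  holds_vals (arr_den :: arr_num :: arr_weight_sum :: arr_weight :: arr_elim :: arr_arc_sum
    :: arr_arc :: inputs) s ->
  (c < n * n)%N -> ev s counter c%:Z -> ev s next_expr (cell_val (next_config R I X) c).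
Proof.
move=> hs cn hc; have hn := ev_nodes hs isT; have nz := instance_gt0 I.
have hi := ev_divn hc hn; have hj := ev_modn hc hn.
have jn : (c %% n < n)%N by rewrite ltn_pmod.
have in_ : (c %/ n < n)%N by rewrite ltn_divLR.
have hf := ev_arr hs (a := arr_fragile) isT hc cn.
have hnum := ev_arr hs (a := arr_num) isT hi in_.
have jN : (c %% n < N)%N by rewrite ltnS ltnW.
have hw := ev_arr hs (a := arr_weight) isT hj jN.
have hd := ev_out_arcs hs (e := (counter / nodes)%X) isT isT (ltnW in_ : (c %/ n < N)%N) hi.
have h := ev_mul hf (ev_nonneg (ev_sub hnum (ev_mul hw hd))).
apply: ev_eq h _.
rewrite /= /cell_val; set i := Ordinal in_; set j := Ordinal jn.
rewrite -[(c %/ n)%N]/(nat_of_ord i) -[(c %% n)%N]/(nat_of_ord j) !has_arcE mul_boolz.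
have [fij|fij] := boolP ((i, j) \in fragile I); last first.
  by rewrite mulr0n inE (negPf fij).
have eij := fintype.subsetP (fragile_sub I) _ fij.
have li := edge_live eij; rewrite (in_next_config live_neq goodX eij) fij mulr1n /=.
congr (nat_of_bool _)%:Z; rewrite -[(c %/ n)%N]/(nat_of_ord i).
rewrite -[(c %% n)%N]/(nat_of_ord j) subr_ge0 -(ler_int R) intrM weight_valE num_live //.
have den0 : 0 < (den_val i)%:~R :> R by rewrite ltr0z den_live.
rewrite -[in RHS](ler_pM2l den0) /den_val !intrM; congr (_ <= _).
by rewrite out_arcsE; ring.
Qed.

Lemma diff_sum_eq0 :
  (\sum_(0 <= b < n * n) diff_val b * diff_val b == 0) = (next_config R I X == X).
Proof.
have nz := instance_gt0 I; rewrite big_mkord psumr_eq0; last by move=> b _;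
  rewrite -expr2 sqr_ge0.
apply/allP/eqP => [diff0|e]; last by move=> b _; rewrite /diff_val e subrr.
apply/setP => -[i j]; have ij : (i * n + j < n * n)%N by rewrite cell_lt.
have := diff0 (Ordinal ij) (mem_index_enum _); rewrite /= mulf_eq0 orbb subr_eq0.
rewrite /cell_val cell_div // cell_mod // !has_arcE.
by case: (_ \in next_config _ _ _); case: (_ \in X).
Qed.

Lemma frame_update a p z s : frame a s (update s a p z).
Proof. by move=> b q /negPf ba _; rewrite /update ba. Qed.

Lemma ev_weight_sum_expr s c :
  holds_vals (arr_weight :: arr_elim :: arr_arc_sum :: arr_arc :: inputs) s ->
  (0 < c < (N * N).+1)%N -> ev s counter c%:Z ->
  ev s weight_sum_expr (arc_val c.-1 * weight_val (c.-1 %% N)).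
Proof.
move=> hs /andP[c0 cN] hc; have hp := ev_pred c0 hc; have hN := ev_stride hs isT.
have cN' : (c.-1 < N * N)%N by rewrite prednK.
have mN : (c.-1 %% N < N)%N by rewrite ltn_pmod.
exact: (ev_mul (ev_arr hs (a := arr_arc) isT hp cN')
  (ev_arr hs (a := arr_weight) isT (ev_modn hp hN) mN)).
Qed.

Lemma ev_diff_sum_expr L s c : arr_next \in L -> arr_config \in L ->
  holds_vals L s -> (0 < c < (n * n).+1)%N -> ev s counter c%:Z ->
  ev s diff_sum_expr (diff_val c.-1 * diff_val c.-1).
Proof.
move=> nL cL hs /andP[c0 cn] hc; have hp := ev_pred c0 hc.
have cn' : (c.-1 < n * n)%N by rewrite prednK.
have hd := ev_sub (ev_arr hs (a := arr_next) nL hp cn') (ev_arr hs (a := arr_config) cL hp cn').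
exact: (ev_mul hd hd).
Qed.

End Pass.

(** * The program and its execution *)

Definition init : cmd :=
  fill arr_config (Const 0) (nodes * nodes)%X (Read arr_fragile counter).

Definition body : cmd :=
  Seq (fill arr_arc (Const 0) (stride * stride)%X arc_expr)
  (Seq (prefix_sum arr_arc_sum (stride * stride + Const 1)%X (Read arr_arc (counter - Const 1)))
  (Seq (fill arr_elim (Const 0) (stride * stride)%X system_expr)
  (Seq (fill arr_elim (stride * stride)%X (stride * stride * stride)%X elim_step_expr)
  (Seq (fill arr_weight (Const 0) stride weight_expr)
  (Seq (prefix_sum arr_weight_sum (stride * stride + Const 1)%X weight_sum_expr)
  (Seq (fill arr_num (Const 0) nodes num_expr)
  (Seq (fill arr_den (Const 0) nodes den_expr)
  (Seq (fill arr_next (Const 0) (nodes * nodes)%X next_expr)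
  (Seq (prefix_sum arr_diff_sum (nodes * nodes + Const 1)%X diff_sum_expr)
  (Seq (Write arr_changed (Const 0) changed_expr)
       (fill arr_config (Const 0) (nodes * nodes)%X (Read arr_next counter)))))))))))).

(* The new configuration replaces the old one by a separate fill, as the
   values of arr_config are no longer those prescribed by table. *)
Lemma run_config (R : realType) n (I : instance n) (X Y : {set 'I_n * 'I_n}) L src s :
  holds_vals R I X L s -> arr_config \notin L -> arr_counter \notin L ->
  arr_params \in L -> src != arr_config -> src != arr_counter ->
  (forall c, (c < n * n)%N -> s src c%:Z = cell_val Y c) ->
  exists s', [/\ run n (fill arr_config (Const 0) (nodes * nodes)%X (Read src counter)) s s'
      (fill_factor (Const 0) (nodes * nodes)%X (Read src counter)),
    (forall c, (c < n * n)%N -> s' arr_config c%:Z = cell_val Y c)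
    & frame arr_config s s'].
Proof.
move=> hs aL cL pL sc sk hY.
have nB : (n * n <= 2 ^ word_size n)%N := table_size_le I arr_config.
have [|t [s' [ex [fr _ frf _] le]]] := exec_fill (word_size_gt0 n) (a := arr_config) (l :=
  0) (h := n * n)
    (lo := Const 0) (hi := (nodes * nodes)%X) (e := Read src counter) (f :=
      cell_val Y) isT isT nB (ev0 n s).
  move=> c s' /andP[_ ch] [fr _ _ cnt]; have hs' := holds_vals_frame fr aL cL hs.
  have hn := ev_nodes hs' pL; split=> [|cn]; first exact: (ev_muln hn hn).
  have hc : ev (word_size n) s' counter c%:Z.
    apply: ev_read (ev0 n s') cnt _; exact: (leq_trans ch nB).
  apply: ev_read hc _ _; first by rewrite fr // hY.
  by rewrite (leq_trans (cell_val_le _ _)) // expn_gt0.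
exists s'; split=> //; exists t => //; apply: leq_trans le _; rewrite -mulnA leq_mul2l leq_mul2r.
by rewrite (table_size_lt I arr_config) ?orbT.
Qed.

(** F is quantified before the instance: it is the sum of the factors of the commands, found by
    unification when the runs are composed. Nothing is assumed on the work arrays, and the input
    arrays end up describing the next configuration, so passes can be chained. *)
Lemma run_body : exists F, forall (R : realType) n (I : instance n) (X : {set 'I_n * 'I_n}) s,
  (forall i, i != target I -> live I i) -> good R I X -> holds_vals R I X inputs s ->
  exists s', [/\ run n body s s' F, holds_vals R I (next_config R I X) inputs s',
    forall i : 'I_n, s' arr_num (i : nat)%:Z = num_val I X i /\
      s' arr_den (i : nat)%:Z = den_val I X i
    & s' arr_changed 0 = ((next_config R I X != X) : nat)%:Z].
Proof.
eexists => R n I X s0 live_neq goodX hs0; have nz := instance_gt0 I.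
have evS L s : holds_vals R I X L s -> arr_params \in L ->
  ev (word_size n) s (stride * stride)%X (n.+1 * n.+1)%N%:Z.
  by move=> hs pL; have hN := ev_stride hs pL; apply: (ev_muln hN hN).
have evn L s : holds_vals R I X L s -> arr_params \in L ->
  ev (word_size n) s (nodes * nodes)%X (n * n)%N%:Z.
  by move=> hs pL; have hn := ev_nodes hs pL; apply: (ev_muln hn hn).
have [|||s1 [r1 hs1 _]] := run_table (a := arr_arc) (l := 0) (e := arc_expr)
  (hi := (stride * stride)%X) (lo := Const 0) hs0 isT isT isT isT _ (ev0 n s0).
- by [].
- by move=> s hs; apply: evS hs isT.
- by move=> c s /andP[_ cN] hs _ hc; apply: (ev_arc_expr goodX hs cN hc).
have [|||s2 [r2 hs2 _]] := run_prefix_sum (a := arr_arc_sum) (f := arc_val I X)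
  (hi := (stride * stride + Const 1)%X) (e :=
    Read arr_arc (counter - Const 1)%X) hs1 isT isT isT isT _.
- by [].
- by move=> s hs; apply: ev_succ (evS _ _ hs isT).
- move=> c s /andP[c0 cN] hs hc.
  by apply: (ev_arr hs (a := arr_arc) isT (ev_pred c0 hc)); rewrite prednK.
have [||||s3 [r3 hs3 f3 _]] := run_fill (a := arr_elim) (l := 0) (h := n.+1 * n.+1) (e :=
  system_expr)
  (hi := (stride * stride)%X) (lo := Const 0) hs2 isT isT isT _ _ (ev0 n s2).
- by rewrite leq_pmulr.
- by [].
- by move=> s hs; apply: evS hs isT.
- by move=> c s /andP[_ cN] hs _ hc; apply: (ev_system_expr hs cN hc).
have [|||s4 [r4 hs4 _]] := run_table (a := arr_elim) (e := elim_step_expr)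
  (hi := (stride * stride * stride)%X) (lo :=
    (stride * stride)%X) hs3 isT isT isT _ f3 (evS _ _ hs3 isT).
- by rewrite leq_pmulr.
- by move=> s hs; apply: ev_muln (evS _ _ hs isT) (ev_stride hs isT).
- by move=> c s cN hs sa hc; apply: (ev_elim_step_expr live_neq goodX hs cN sa hc).
have [|||s5 [r5 hs5 _]] := run_table (a := arr_weight) (l := 0) (e := weight_expr)
  (hi := stride) (lo := Const 0) hs4 isT isT isT isT _ (ev0 n s4).
- by [].
- by move=> s hs; apply: ev_stride hs isT.
- by move=> c s /andP[_ cN] hs _ hc; apply: (ev_weight_expr hs cN hc).
have [|||s6 [r6 hs6 _]] := run_prefix_sum (a := arr_weight_sum)
  (f := fun b => arc_val I X b * weight_val I X (b %% n.+1))
  (hi := (stride * stride + Const 1)%X) (e := weight_sum_expr) hs5 isT isT isT isT _.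
- by [].
- by move=> s hs; apply: ev_succ (evS _ _ hs isT).
- by move=> c s cN hs hc; apply: (ev_weight_sum_expr hs cN hc).
have [|||s7 [r7 hs7 _]] := run_table (a := arr_num) (l := 0) (e := num_expr)
  (hi := nodes) (lo := Const 0) hs6 isT isT isT isT _ (ev0 n s6).
- by [].
- by move=> s hs; apply: ev_nodes hs isT.
- by move=> c s /andP[_ cN] hs _ hc; apply: (ev_num_expr hs cN hc).
have [|||s8 [r8 hs8 _]] := run_table (a := arr_den) (l := 0) (e := den_expr)
  (hi := nodes) (lo := Const 0) hs7 isT isT isT isT _ (ev0 n s7).
- by [].
- by move=> s hs; apply: ev_nodes hs isT.
- by move=> c s /andP[_ cN] hs _ hc; apply: (ev_den_expr hs cN hc).
have [|||s9 [r9 hs9 _]] := run_table (a := arr_next) (l := 0) (e := next_expr)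
  (hi := (nodes * nodes)%X) (lo := Const 0) hs8 isT isT isT isT _ (ev0 n s8).
- by [].
- by move=> s hs; apply: evn hs isT.
- by move=> c s /andP[_ cN] hs _ hc; apply: (ev_next_expr live_neq goodX hs cN hc).
have [|||s10 [r10 hs10 _]] := run_prefix_sum (a := arr_diff_sum)
  (f := fun b => diff_val R I X b * diff_val R I X b)
  (hi := (nodes * nodes + Const 1)%X) (e := diff_sum_expr) hs9 isT isT isT isT _.
- by [].
- by move=> s hs; apply: ev_succ (evn _ _ hs isT).
- by move=> c s cN hs hc; apply: (ev_diff_sum_expr _ _ hs cN hc).
have ev_changed : ev (word_size n) s10 changed_expr (next_config R I X != X)%:Z.
  have hd := ev_arr hs10 (a := arr_diff_sum) isT (evn _ _ hs10 isT) (ltnSn _).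
  have hq := ev_not (ev_eqe hd (ev0 n s10)).
  by apply: ev_eq hq _; rewrite -(diff_sum_eq0 R I X).
have r11 := run_write arr_changed (ev0 n s10) ev_changed.
set s11 := update _ _ _ _ in r11.
have fr11 : frame arr_changed s10 s11 by apply: frame_update.
have hs11 := (fun aL cL => holds_vals_frame fr11 aL cL hs10) isT isT.
have hp11 : holds_vals R I X [:: arr_params] s11.
  by move=> a; rewrite inE => /eqP ->; apply: (hs11 arr_params).
have [s12 [r12 hc12 f12]] := run_config (src := arr_next) (Y := next_config R I X)
  hp11 isT isT isT isT isT (hs11 arr_next isT).
exists s12; split.
- exact: run_seq r1 (run_seq r2 (run_seq r3 (run_seq r4 (run_seq r5 (run_seq r6 (run_seq r7
    (run_seq r8 (run_seq r9 (run_seq r10 (run_seq r11 r12)))))))))).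
- move=> a; rewrite !inE => /or4P[] /eqP -> c ca;
  [rewrite f12 //|rewrite f12 //|rewrite f12 //|exact: hc12].
  + exact: (hs11 arr_params).
  + exact: (hs11 arr_edges).
  + exact: (hs11 arr_fragile).
- by move=> i; rewrite !f12 //; split; [apply: (hs11 arr_num) | apply: (hs11 arr_den)].
- by rewrite f12 // /s11 /update !eqxx.
Qed.

(** * Polynomial running time *)

Section Rank.
Variables (R : realType) (n : nat) (I : instance n).
Local Notation v := (target I).

(** The arcs are those of the full graph, which is the graph of the first configuration; L enters
    the exponent of the bound on its hitting times. *)
Definition ranking (g : 'I_n -> nat) (L : nat) : Prop :=
  [/\ g v = 0%N, forall i, (g i <= L)%N
    & forall i, i != v -> exists2 j, (i, j) \in edges I & (g j < g i)%N].

(** The rank of i is the least t with [Q i t], a distance to v in both applications. *)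
Lemma ranking_of_reach (Q : 'I_n -> nat -> Prop) L : Q v 0%N ->
  (forall i, exists2 t, Q i t & (t <= L)%N) ->
  (forall i t, i != v -> Q i t -> exists j t', [/\ (i, j) \in edges I, Q j t' & (t' < t)%N]) ->
  exists g, ranking g L.
Proof.
move=> Qv QL Qstep; have ex i : exists t, `[< Q i t >].
  by have [t Qt _] := QL i; exists t; apply/asboolP.
exists (fun i => ex_minn (ex i)); split=> [|i|i iv].
- by case: ex_minnP => t _ /(_ 0%N); rewrite leqn0 => le0; apply/eqP/le0/asboolP.
- case: ex_minnP => t _ mint; have [t' Qt' tL] := QL i.
  by apply: leq_trans tL; apply/mint/asboolP.
- case: (ex_minnP (ex i)) => t /asboolP Qt _; have [j [t' [ij Qj lt]]] := Qstep i t iv Qt.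
  exists j => //; case: ex_minnP => u _ minu; apply: leq_ltn_trans lt.
  exact/minu/asboolP.
Qed.

Lemma AR_ranking : AR R I -> exists g L, ranking g L.
Proof.
case=> X cX reach; have [t tP] := choice reach.
suff [g gP] : exists g, ranking g (\max_i t i)%N by exists g, (\max_i t i)%N.
apply: (ranking_of_reach (Q := fun i t => 0 < (transition R I X ^+ t) v i)).
- by rewrite expr0 mxE eqxx.
- by move=> i; exists (t i); [apply: tP | apply: leq_bigmax].
move=> i [|u] iv; first by rewrite expr0 mxE eq_sym (negPf iv) ltxx.
(* As [transition] is column-stochastic, the first step of the walk is the rightmost factor of the
   power. *)
rewrite exprSr -[_ * _]/(_ *m _) mxE => sum_gt0.
have [j jP] : exists j, 0 < (transition R I X ^+ u) v j * transition R I X j i.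
  apply/existsP; apply: contraLR sum_gt0 => /existsPn le0; rewrite -leNgt.
  by apply: sumr_le0 => j _; rewrite leNgt le0.
have Pji : 0 < transition R I X j i.
  rewrite lt_neqAle transition_ge0 andbT eq_sym; apply: contraTneq jP => ->.
  by rewrite mulr0 ltxx.
exists j, u; split=> //; last by rewrite -(pmulr_lgt0 _ Pji).
apply: (fintype.subsetP (present_sub cX)); apply: contraTT Pji => /negPf ij.
by rewrite transitionE ij ltxx.
Qed.

Lemma ABR_ranking kappa : ABR I kappa -> exists g, ranking g kappa.
Proof.
move=> abr; pose fixed_path i p := path (fun x y => (x, y) \in fixed I) i p && (last i p == v).
apply: (ranking_of_reach (Q := fun i t => exists2 p, fixed_path i p & size p = t)).
- by exists [::]; rewrite /fixed_path //= eqxx.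
- move=> i; have [p [pP pv sp]] := abr i; exists (size p) => //.
  by exists p; rewrite /fixed_path // pP pv eqxx.
move=> i t iv [[|j p]]; rewrite /fixed_path /=; first by rewrite (negPf iv).
case/andP=> /andP[ij jp] pv <-; exists j, (size p); split=> //.
  by move: ij; rewrite inE => /andP[].
by exists p; rewrite // jp pv.
Qed.

Variables (g : 'I_n -> nat) (L : nat).
Hypothesis gL : ranking g L.

Lemma ranking_live i : i != v -> live I i.
Proof. by case: gL => _ _ gstep /gstep[j ij _]; apply: edge_live ij. Qed.

Lemma ranking_hitting_time i : live I i ->
  (hitting_time R I (fragile I) i <= (((2 * n) ^ L).+1%:R)%:E)%E.
Proof.
case: gL => gv gle gstep; apply: hitting_time_rank gv gle _ i => i /gstep[j ij lt_ji].
by exists j; rewrite ?present_fragile.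
Qed.

Lemma ranking_good : good R I (fragile I).
Proof.
split=> [|i li]; first exact: fintype.subxx.
rewrite ge0_fin_numE ?hitting_time_ge0 //.
exact: le_lt_trans (ranking_hitting_time li) (ltry _).
Qed.

Lemma ranking_hit i : live I i -> finite_hit R I (fragile I) i <= ((2 * n) ^ L).+1%:R.
Proof.
move=> li; rewrite -lee_fin -hitting_time_hit //; last exact: ranking_good.
exact: ranking_hitting_time.
Qed.

End Rank.

(** * Encoding of the instance and initialization *)

Section Input.
Variables (R : realType) (n : nat) (I : instance n).

Lemma bitmap_cell (S : {set 'I_n * 'I_n}) c : (c < n * n)%N -> bitmap S c%:Z = cell_val S c.
Proof.
move=> cn; rewrite /bitmap /cell_val /has_arc; congr (nat_of_bool _)%:Z.
apply: eq_existsb => e; congr (_ && _); rewrite /position eqz_nat.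
apply/eqP/andP => [->|[/eqP -> /eqP ->]]; last by rewrite -divn_eq.
by rewrite cell_div ?cell_mod.
Qed.

Lemma holds_vals_input X : holds_vals R I X [:: arr_params; arr_edges; arr_fragile] (input I).
Proof.
move=> a; rewrite !inE => /or3P[] /eqP -> c ca; rewrite /input /=; last 2 first.
- exact: bitmap_cell.
- exact: bitmap_cell.
by case: c ca => [|[|]].
Qed.

Lemma holds_vals_config X s : holds_vals R I X inputs s -> holds_config s X.
Proof.
move=> hs [i j]; rewrite (hs arr_config isT) /table /arr_config /cell_val /=.
  by rewrite cell_div // cell_mod // has_arcE.
by rewrite cell_lt.
Qed.

Lemma run_init : exists s,
  run n init (input I) s (fill_factor (Const 0) (nodes * nodes)%X (Read arr_fragile counter))
  /\ holds_vals R I (fragile I) inputs s.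
Proof.
have hs := @holds_vals_input (fragile I).
have [s [rs cs fr]] := run_config (src := arr_fragile) (Y :=
  fragile I) hs isT isT isT isT isT (hs arr_fragile isT).
exists s; split=> // a; rewrite !inE => /or4P[] /eqP -> c ca;
  [rewrite fr //|rewrite fr //|rewrite fr //|exact: cs].
- exact: (hs arr_params).
- exact: (hs arr_edges).
- exact: (hs arr_fragile).
Qed.

End Input.

Lemma poly_nat_monomial (C d : nat) : exists p : {poly nat}, forall x : nat,
  p.[x]%R = (C * x.+1 ^ d)%N.
Proof.
exists (C%:P * ('X + 1) ^+ d) => x.
by rewrite hornerM hornerC horner_exp hornerD hornerX hornerC -addn1 natrXE.
Qed.

Lemma runs_bound (F0 F kappa : nat) : exists C d : nat, forall n k T : nat, (0 < n)%N ->
  (k <= n * ((2 * n) ^ kappa).+1 * (2 * word_size n + 2 * ((2 * n) ^ kappa).+1 + 1) + 2)%N ->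
  (T <= F0 * ((n.+1 * n.+1 * n.+1).+2 * word_size n ^ 2)
      + k * (F * ((n.+1 * n.+1 * n.+1).+2 * word_size n ^ 2)).+1)%N ->
  (T <= C * n.+1 ^ d)%N.
Proof.
pose K := (2 * 2 ^ kappa)%N.
(* With N = n + 1, q = N^kappa and K = 2 * 2^kappa, the bound b on the hitting times is at most K q,
   so there are O(q^2 N^3) passes. The cost unit is at most 3 N^3 (8 N^2)^2 = 192 N^7. The exponents
   add up to 2 kappa + 10. *)
exists ((F0 + F + 1) * (K * (17 + 2 * K) + 3) * 192)%N, (2 * kappa + 10)%N => n k T n0 k_le T_le.
set N := n.+1 in T_le *; have N1 : (1 <= N)%N by [].
pose q := (N ^ kappa)%N; have q1 : (1 <= q)%N by rewrite expn_gt0.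
have b_le : (((2 * n) ^ kappa).+1 <= K * q)%N.
  have le1 : ((2 * n) ^ kappa <= 2 ^ kappa * q)%N.
    by rewrite -expnMn; case: (kappa) => // c; rewrite leq_exp2r // leq_mul2l leqnSn.
  have : (1 <= 2 ^ kappa * q)%N by rewrite muln_gt0 expn_gt0.
  by rewrite /K -mulnA; lia.
have k1_le : (k.+1 <= (K * (17 + 2 * K) + 3) * (q * q * N ^ 3))%N.
  have le1 : (2 * word_size n + 2 * ((2 * n) ^ kappa).+1 + 1 <= (17 + 2 * K) * (q * N ^ 2))%N.
    have qN : (1 <= q * N ^ 2)%N by rewrite muln_gt0 q1 expn_gt0.
    have N2 : (N ^ 2 <= q * N ^ 2)%N by rewrite leq_pmull.
    have qq : (K * q <= K * (q * N ^ 2))%N by rewrite leq_mul2l leq_pmulr ?expn_gt0 ?orbT.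
    have arith x y z t : (y <= t -> z <= x -> 1 <= x ->
        2 * (8 * z) + 2 * y + 1 <= 17 * x + 2 * t)%N by lia.
    by rewrite /word_size -/N mulnDl -[(2 * K * _)%N]mulnA; apply: arith;
      rewrite ?(leq_trans b_le).
  have le2 : (n * ((2 * n) ^ kappa).+1 * (2 * word_size n + 2 * ((2 * n) ^ kappa).+1 + 1)
      <= N * (K * q) * ((17 + 2 * K) * (q * N ^ 2)))%N.
    by apply: leq_mul le1; apply: leq_mul b_le; apply: leqnSn.
  have eqN : (N * (K * q) * ((17 + 2 * K) * (q * N ^ 2)) = K * (17 + 2 * K) * (q * q * N ^ 3))%N.
    by rewrite (expnS N 2); ring.
  have : (1 <= q * q * N ^ 3)%N by rewrite !muln_gt0 q1 ?expn_gt0.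
  by rewrite mulnDl; lia.
have W_le : ((N * N * N).+2 * word_size n ^ 2 <= 192 * N ^ 7)%N.
  have -> : (192 * N ^ 7 = 3 * (N * N * N) * word_size n ^ 2)%N by rewrite /word_size -/N; ring.
  rewrite leq_mul2r; apply/orP; right.
  have : (1 <= N * N * N)%N by rewrite !muln_gt0.
  by move: (N * N * N)%N; lia.
have W1 : (1 <= (N * N * N).+2 * word_size n ^ 2)%N by rewrite muln_gt0 expn_gt0.
set W := (_ * word_size n ^ 2)%N in T_le W_le W1.
apply: leq_trans T_le _; apply: (@leq_trans ((F0 + F + 1) * k.+1 * W)%N).
  by clear -W1; move: W W1 => W W1; nia.
have -> : (N ^ (2 * kappa + 10) = q * q * N ^ 3 * N ^ 7)%N.
  by rewrite /q -!expnD; congr (_ ^ _)%N; lia.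
apply: leq_trans (leq_mul (leq_mul (leqnn (F0 + F + 1)) k1_le) W_le) _.
by rewrite leq_eqVlt; apply/orP; left; apply/eqP; ring.
Qed.

Theorem theorem4p1 (R : realType) :
  (forall (n : nat) (I : instance n),
     AD I -> AR R I ->
     exists k : nat, terminates_at R I k /\ solves R I k)
  /\
  (exists init body : cmd,
     forall kappa : nat, exists p : {poly nat},
     forall (n : nat) (I : instance n),
       ABR I kappa ->
       exists k T : nat,
         [/\ terminates_at R I k,
             solves R I k,
             runs_iteration R I init body k T
           & (T <= p.[input_size I]%R)%N]).
Proof.
split=> [n I _ /AR_ranking[g [L gP]]|].
  have live_neq := ranking_live gP; have good0 := ranking_good R gP.
  have [k kP] := terminates live_neq good0.
  by exists k; split=> //; apply: terminates_solves.
have [F bodyF] := run_body.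
exists init, body => kappa.
have [C [d boundT]] := runs_bound (fill_factor (Const 0) (nodes * nodes)%X (Read arr_fragile
  counter)) F kappa.
have [p pE] := poly_nat_monomial C d; exists p => n I /ABR_ranking[g gP].
have nz := instance_gt0 I.
have live_neq := ranking_live gP; have good0 := ranking_good R gP.
have goodk := good_iterate live_neq good0.
have [k0 k0P] := terminates live_neq good0.
have [] := terminates_fast (b := ((2 * n) ^ kappa).+1) (beta :=
  word_size n) live_neq good0 isT _ _ k0P.
- by move=> i li; apply: ranking_hit gP _ li.
- move=> X i goodX li; exists (den_val I X i), (num_val I X i); split.
  + exact: den_live live_neq goodX _ li.
  + have := @table_le R n I X arr_den i (ltn_ord i).
    by have := den_live live_neq goodX li; rewrite /table /=; lia.
  + by rewrite (num_live live_neq goodX).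
move=> k kP k_le.
have [s0 [[t0 ex0 le0] hs0]] := run_init R I.
(* The states of the run come from the axiom of choice, which requires a successor for every pair;
   outside the invariant [stepP] holds vacuously. *)
pose stepP (q : {set 'I_n * 'I_n} * store) s' := good R I q.1 -> holds_vals R I q.1 inputs q.2 ->
  [/\ run n body q.2 s' F, holds_vals R I (next_config R I q.1) inputs s',
    forall i : 'I_n, s' arr_num (i : nat)%:Z = num_val I q.1 i /\
      s' arr_den (i : nat)%:Z = den_val I q.1 i
    & s' arr_changed 0 = ((next_config R I q.1 != q.1) : nat)%:Z].
have stepE q : exists s', stepP q s'.
  have [[gX hX]|no] := pselect (good R I q.1 /\ holds_vals R I q.1 inputs q.2).
    by have [s' s'P] := bodyF R n I q.1 q.2 live_neq gX hX; exists s'.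
  by exists q.2 => gX hX; case: no.
have [next nextP] := choice stepE.
pose s := fix s j := if j is j'.+1 then next (iterate R I j', s j') else s0.
have hs j : holds_vals R I (iterate R I j) inputs (s j).
  elim: j => [|j IH]; first exact: hs0.
  by have [_ h _ _] := nextP (iterate R I j, s j) (goodk j) IH; apply: h.
have step j : [/\ run n body (s j) (s j.+1) F, holds_vals R I (iterate R I j.+1) inputs (s j.+1),
    forall i : 'I_n, s j.+1 arr_num (i : nat)%:Z = num_val I (iterate R I j) i /\
      s j.+1 arr_den (i : nat)%:Z = den_val I (iterate R I j) i
    & s j.+1 arr_changed 0 = ((iterate R I j.+1 != iterate R I j) : nat)%:Z].
  exact: nextP (iterate R I j, s j) (goodk j) (hs j).
have [t tP] := choice (fun j => let: And4 (ex_intro2 u ex le) _ _ _ := step j in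
  ex_intro (fun u => exec body (s j) u (s j.+1)
    /\ (u <= F * ((n.+1 * n.+1 * n.+1).+2 * word_size n ^ 2))%N) u (conj ex le)).
exists k, (t0 + \sum_(j < k) (t j).+1)%N; split=> //.
- exact: terminates_solves.
- exists s, t0, t; split=> //.
  + split; [exact: ex0 | exact: holds_vals_config hs0].
  + by move=> j _; case: (tP j).
  + move=> j _; have [_ h numden changed] := step j; split.
    * move=> i; have [-> ->] := numden i; exact: num_den_val.
    * exact: holds_vals_config h.
    * exact: changed.
rewrite pE; apply: leq_trans (boundT n k _ nz k_le _) _.
  apply: leq_add le0 _; rewrite -[X in (_ <= X * _)%N]card_ord -sum_nat_const.
  by apply: leq_sum => j _; rewrite ltnS; case: (tP j).
(* The input size is at least n, so a bound in terms of n suffices. *)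
rewrite leq_mul2l; apply/orP; right; case: (d) => // d'.
by rewrite leq_exp2r // ltnS leq_addr.
Qed.
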